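(* Let $q$ be a power of a prime. Then the curve $\mathbb{P}^1_{[q,2]}$ is isomorphic over $\mathbb{F}_q$ to the plane curve $B\subset \mathbb{P}^2$, where $B$ is the image (with its reduced scheme structure) of the morphism $\Phi:\mathbb{P}^1\to\mathbb{P}^2$ over $\mathbb{F}_q$ given by $(s:t)\mapsto (s^{q+1}: s^qt+st^q : t^{q+1})$.
   Context: Definition of $C_{[q,2]}$. Let $C$ be a smooth, geometrically connected projective curve over $\mathbb{F}_q$, and let $F_q$ be the Frobenius acting on $C(\overline{\mathbb{F}}_q)$. The curve $C_{[q,2]}$ is the seminormal, geometrically integral projective curve over $\mathbb{F}_q$ with normalization $C$ obtained from $C$ by gluing each two-element orbit $\{P,F_q(P)\}$ of $F_q$ on $C(\mathbb{F}_{q^2})\setminus C(\mathbb{F}_q)$ to a single point, distinct orbits being sent to distinct points, and changing nothing elsewhere. Explicitly: each two-element orbit corresponds to a closed point $Q$ of $C$ of degree $2$ (residue field $\mathbb{F}_{q^2}$). The normalization map $u:C\to C_{[q,2]}$ is a homeomorphism on the scheme-theoretic closed points, is an isomorphism away from the points of degree $2$, and the local ring of $C_{[q,2]}$ at $u(Q)$, for $Q$ of degree $2$ with maximal ideal $\mathfrak{m}_Q\subset\mathcal{O}_{C,Q}$, is the subring $\{f\in\mathcal{O}_{C,Q} : f \bmod \mathfrak{m}_Q\in\mathbb{F}_q\}$. Thus $u(Q)$ is an $\mathbb{F}_q$-rational point which over $\overline{\mathbb{F}}_q$ is an ordinary node whose two branches are exchanged by Frobenius. $\mathbb{P}^1_{[q,2]}$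 denotes this construction for $C=\mathbb{P}^1$ over $\mathbb{F}_q$. *)

(* Defs.v *)
From HB Require Import structures.
From mathcomp Require Import all_boot all_order all_algebra.
From mathcomp Require Export mpoly.
From mathcomp Require Import boolp classical_sets functions.
From mathcomp Require Import topology_structure subtype_topology.

Set Implicit Arguments.
Unset Strict Implicit.
Unset Printing Implicit Defensive.

Import GRing.Theory.
Local Open Scope classical_set_scope.
Local Open Scope ring_scope.
Local Open Scope quotient_scope.

(* A reduced scheme over k, seen as a space with a sheaf of k-algebras.       *)
(* On a reduced scheme a section over an open U is determined by its values   *)
(* in the residue fields at the points of U (generic points included), so     *)
(* O(U) is given as a set reg U of functions on U with value at x in a field  *)
(* fld x. The field fld x may be larger than the residue field of x, which is *)
(* recovered as residue x below.                                              *)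
Record rspace (k : fieldType) := RSpace {
  pts :> topologicalType;
  fld : pts -> fieldType;
  emb : forall x, {rmorphism k -> fld x};
  reg : forall U : set pts, set (forall x, U x -> fld x);
  reg_const : forall (U : set pts) (c : k), open U ->
    reg (fun x (_ : U x) => emb x c);
  reg_add : forall (U : set pts) (s t : forall x, U x -> fld x), open U ->
    reg s -> reg t -> reg (fun x hx => s x hx + t x hx);
  reg_mul : forall (U : set pts) (s t : forall x, U x -> fld x), open U ->
    reg s -> reg t -> reg (fun x hx => s x hx * t x hx);
  reg_res : forall (U V : set pts) (VU : V `<=` U)
      (s : forall x, U x -> fld x), open U -> open V ->
    reg s -> reg (fun x (hx : V x) => s x (VU x hx));
  reg_glue : forall (U : set pts) (s : forall x, U x -> fld x), open U ->
    (forall x, U x -> exists V (t : forall y, V y -> fld y),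
       [/\ open V, V x, reg t & forall y hU hV, s y hU = t y hV]) ->
    reg s
}.

Arguments emb {k r} x.
Arguments reg {k r U}.

Definition sections (k : fieldType) (X : rspace k) (U : set X) :=
  forall x : X, U x -> fld x.

(* Isomorphisms of ringed spaces over k; a morphism of schemes being a        *)
(* morphism of locally ringed spaces, these are the isomorphisms of schemes   *)
(* over k. iso_sec V is only meaningful on the regular sections over an       *)
(* open V, where it is an isomorphism of k-algebras.                          *)
Record iso (k : fieldType) (X Y : rspace k) := Iso {
  iso_fun : X -> Y;
  iso_inv : Y -> X;
  iso_funK : cancel iso_fun iso_inv;
  iso_invK : cancel iso_inv iso_fun;
  iso_fun_continuous : continuous iso_fun;
  iso_inv_continuous : continuous iso_inv;
  iso_sec : forall V : set Y, sections V -> sections (iso_fun @^-1` V);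
  iso_sec_reg : forall (V : set Y) (s : sections V), open V ->
    reg s -> reg (iso_sec s);
  iso_sec_inj : forall (V : set Y) (s t : sections V), open V ->
    reg s -> reg t -> iso_sec s = iso_sec t -> s = t;
  iso_sec_surj : forall (V : set Y) (t : sections (iso_fun @^-1` V)), open V ->
    reg t -> exists2 s : sections V, reg s & iso_sec s = t;
  iso_sec_const : forall (V : set Y) (c : k), open V ->
    iso_sec (fun y (_ : V y) => emb y c) = fun x _ => emb x c;
  iso_sec_add : forall (V : set Y) (s t : sections V), open V ->
    reg s -> reg t ->
    iso_sec (fun y hy => s y hy + t y hy)
      = fun x hx => iso_sec s hx + iso_sec t hx;
  iso_sec_mul : forall (V : set Y) (s t : sections V), open V ->
    reg s -> reg t ->
    iso_sec (fun y hy => s y hy * t y hy)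
      = fun x hx => iso_sec s hx * iso_sec t hx;
  iso_sec_res : forall (V W : set Y) (WV : W `<=` V) (s : sections V),
    open V -> open W -> reg s ->
    iso_sec (fun y (hy : W y) => s y (WV y hy))
      = fun x (hx : W (iso_fun x)) => iso_sec s (WV _ hx)
}.

Definition isomorphic (k : fieldType) (X Y : rspace k) := inhabited (iso X Y).

Section Glue.
Variables (k : fieldType) (X : rspace k).

Definition residue (x : X) : set (fld x) :=
  [set v | exists (U : set X) (hx : U x) (s : sections U),
             [/\ open U, reg s & s x hx = v]].

Definition has_degree (n : nat) (x : X) :=
  exists e : 'I_n -> fld x, (forall i, residue (e i)) /\
    forall v, residue v ->
      exists! c : {ffun 'I_n -> k}, v = \sum_(i < n) emb x (c i) * e i.

Definition reg_glue2 (U : set X) (s : sections U) :=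
  reg s /\ forall x (hx : U x), has_degree 2 x -> exists c : k, s x hx = emb x c.

Lemma reg_glue2_const (U : set X) (c : k) : open U ->
  reg_glue2 (fun x (_ : U x) => emb x c).
Proof. by move=> Uo; split; [exact: reg_const | move=> x _ _; exists c]. Qed.

Lemma reg_glue2_add (U : set X) (s t : sections U) : open U ->
  reg_glue2 s -> reg_glue2 t -> reg_glue2 (fun x hx => s x hx + t x hx).
Proof.
move=> Uo [rs ds] [rt dt]; split; first exact: reg_add.
move=> x hx d2; have [a ->] := ds x hx d2; have [b ->] := dt x hx d2.
by exists (a + b); rewrite rmorphD.
Qed.

Lemma reg_glue2_mul (U : set X) (s t : sections U) : open U ->
  reg_glue2 s -> reg_glue2 t -> reg_glue2 (fun x hx => s x hx * t x hx).
Proof.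
move=> Uo [rs ds] [rt dt]; split; first exact: reg_mul.
move=> x hx d2; have [a ->] := ds x hx d2; have [b ->] := dt x hx d2.
by exists (a * b); rewrite rmorphM.
Qed.

Lemma reg_glue2_res (U V : set X) (VU : V `<=` U) (s : sections U) :
  open U -> open V -> reg_glue2 s ->
  reg_glue2 (fun x (hx : V x) => s x (VU x hx)).
Proof.
move=> Uo Vo [rs ds]; split; first exact: reg_res.
by move=> x hx d2; exact: ds.
Qed.

Lemma reg_glue2_glue (U : set X) (s : sections U) : open U ->
  (forall x, U x -> exists V (t : sections V),
     [/\ open V, V x, reg_glue2 t & forall y hU hV, s y hU = t y hV]) ->
  reg_glue2 s.
Proof.
move=> Uo loc; split.
  apply: reg_glue => // x Ux; have [V [t [Vo Vx [rt _] st]]] := loc x Ux.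
  by exists V, t.
move=> x Ux d2; have [V [t [Vo Vx [_ dt] st]]] := loc x Ux.
by rewrite (st x Ux Vx); exact: dt.
Qed.

(* The curve X_[q,2] for k = F_q: same points and same topology as X; the     *)
(* local ring at a point Q of degree 2 is {f in O_(X,Q) | f mod m_Q in k},    *)
(* and the other local rings are unchanged. The class of f mod m_Q is the     *)
(* value of f at Q.                                                           *)
Definition glue2 : rspace k :=
  RSpace reg_glue2_const reg_glue2_add reg_glue2_mul reg_glue2_res
    reg_glue2_glue.

End Glue.

Section Reduced.
Variables (k : fieldType) (X : rspace k) (A : set X).

(* For closed A, the structure sheaf O_X / I_A of the reduced induced         *)
(* structure on A, where I_A is the ideal of the sections vanishing at every  *)
(* point of A: the functions that are locally restrictions of sections of O_X.*)
Definition reg_reduced (V : set A) (s : forall a, V a -> fld (set_val a)) :=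
  forall a, V a -> exists (U : set X) (t : sections U),
    [/\ open U, U (set_val a), reg t &
        forall b (hV : V b) (hU : U (set_val b)), s b hV = t (set_val b) hU].

Lemma reg_reduced_const (V : set A) (c : k) : open V ->
  reg_reduced (fun a (_ : V a) => emb (set_val a) c).
Proof.
move=> Vo a Va; exists setT, (fun x _ => emb x c).
by split => //; [exact: openT | apply: reg_const; exact: openT].
Qed.

Lemma reg_reduced_op (op : forall F : fieldType, F -> F -> F)
    (V : set A) (s t : forall a, V a -> fld (set_val a)) :
  (forall (U : set X) (f g : sections U), open U -> reg f -> reg g ->
     reg (fun x hx => op _ (f x hx) (g x hx))) ->
  reg_reduced s -> reg_reduced t ->
  reg_reduced (fun x hx => op _ (s x hx) (t x hx)).
Proof.
move=> rop rs rt a Va.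
have [U [f [Uo Ua rf sf]]] := rs a Va; have [W [g [Wo Wa rg tg]]] := rt a Va.
have UWo : open (U `&` W) by exact: openI.
exists (U `&` W), (fun x hx => op _ (f x (proj1 hx)) (g x (proj2 hx))).
split => //; last first.
  by move=> b Vb UWb; rewrite (sf _ _ (proj1 UWb)) (tg _ _ (proj2 UWb)).
apply: (rop _ (fun x (hx : (U `&` W) x) => f x (proj1 hx))
              (fun x (hx : (U `&` W) x) => g x (proj2 hx))) => //.
- exact: (reg_res (fun x (hx : (U `&` W) x) => proj1 hx) Uo UWo rf).
- exact: (reg_res (fun x (hx : (U `&` W) x) => proj2 hx) Wo UWo rg).
Qed.

Lemma reg_reduced_add (V : set A) (s t : forall a, V a -> fld (set_val a)) :
  open V -> reg_reduced s -> reg_reduced t ->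
  reg_reduced (fun x hx => s x hx + t x hx).
Proof.
by move=> _; apply: (reg_reduced_op (op := fun F => +%R)); exact: reg_add.
Qed.

Lemma reg_reduced_mul (V : set A) (s t : forall a, V a -> fld (set_val a)) :
  open V -> reg_reduced s -> reg_reduced t ->
  reg_reduced (fun x hx => s x hx * t x hx).
Proof.
by move=> _; apply: (reg_reduced_op (op := fun F => *%R)); exact: reg_mul.
Qed.

Lemma reg_reduced_res (V W : set A) (WV : W `<=` V)
    (s : forall a, V a -> fld (set_val a)) : open V -> open W ->
  reg_reduced s -> reg_reduced (fun a (ha : W a) => s a (WV a ha)).
Proof.
move=> _ _ rs a Wa; have [U [t [Uo Ua rt st]]] := rs a (WV a Wa).
by exists U, t; split => // b Wb Ub; exact: st.
Qed.

Lemma reg_reduced_glue (V : set A) (s : forall a, V a -> fld (set_val a)) :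
  open V ->
  (forall a, V a -> exists W (t : forall b, W b -> fld (set_val b)),
     [/\ open W, W a, reg_reduced t & forall b hV hW, s b hV = t b hW]) ->
  reg_reduced s.
Proof.
move=> Vo loc a Va; have [W [t [[W' Wo' WE] Wa rt st]]] := loc a Va.
have [U [f [Uo Ua rf tf]]] := rt a Wa.
have W'a : W' (set_val a) by move: Wa; rewrite -WE.
have UWo : open (U `&` W') by exact: openI.
exists (U `&` W'), (fun x hx => f x (proj1 hx)); split => //.
  exact: (reg_res (fun x (hx : (U `&` W') x) => proj1 hx) Uo UWo rf).
move=> b Vb UWb.
have Wb : W b by rewrite -WE; exact: (proj2 UWb).
by rewrite (st b Vb Wb) (tf b Wb (proj1 UWb)).
Qed.

Definition reduced_subspace : rspace k :=
  RSpace reg_reduced_const reg_reduced_add reg_reduced_mul reg_reduced_res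
    reg_reduced_glue.

End Reduced.

(* The points of Proj k[X_0, ..., X_n]. *)
Record hprime (k : fieldType) (n : nat) := HPrime {
  hp_mem :> {mpoly k[n.+1]} -> bool;
  hp_ideal : idealr_closed hp_mem;
  hp_prime : prime_idealr_closed hp_mem;
  hp_homog : forall f d, f \in hp_mem -> pihomog mdeg d f \in hp_mem;
  hp_relevant : exists i : 'I_n.+1, 'X_i \notin hp_mem
}.

HB.instance Definition _ (k : fieldType) (n : nat) (x : hprime k n) :=
  isIdealr.Build {mpoly k[n.+1]} (hp_mem x) (hp_ideal x).
HB.instance Definition _ (k : fieldType) (n : nat) (x : hprime k n) :=
  isPrimeIdealrClosed.Build {mpoly k[n.+1]} (hp_mem x) (@hp_prime k n x).

HB.instance Definition _ (k : fieldType) (n : nat) := gen_eqMixin (hprime k n).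
HB.instance Definition _ (k : fieldType) (n : nat) :=
  gen_choiceMixin (hprime k n).

Section Zariski.
Variables (k : fieldType) (n : nat).

Definition zariski_open (U : set (hprime k n)) :=
  forall x, U x -> exists d (f : {mpoly k[n.+1]}),
    [/\ f \is d.-homog, f \notin hp_mem x &
        forall y : hprime k n, f \notin hp_mem y -> U y].

Lemma zariski_openT : zariski_open setT.
Proof.
move=> x _; exists 0%N, 1; split => //; first exact: dhomog1.
by rewrite (idealr1 (hp_mem x)).
Qed.

Lemma zariski_openI : setI_closed zariski_open.
Proof.
move=> U V Uo Vo x [Ux Vx].
have [d [f [hf fx fU]]] := Uo x Ux; have [e [g [hg gx gV]]] := Vo x Vx.
exists (d + e)%N, (f * g); split; first exact: dhomogM.
  by rewrite (prime_idealrM (hp_mem x)) negb_or fx.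
by move=> y; rewrite (prime_idealrM (hp_mem y)) negb_or => /andP[/fU ? /gV].
Qed.

Lemma zariski_open_bigU (I : Type) (f : I -> set (hprime k n)) :
  (forall i, zariski_open (f i)) -> zariski_open (\bigcup_i f i).
Proof.
move=> fo x [i _ fx]; have [d [g [hg gx gf]]] := fo i x fx.
by exists d, g; split => // y /gf; exists i.
Qed.

HB.instance Definition _ := isOpenTopological.Build (hprime k n)
  zariski_openT zariski_openI zariski_open_bigU.

End Zariski.

(* The library gives {ideal_quot I} its ring structure only; as I is prime it  *)
(* is an integral domain, once equipped with (classical) inverses of units.   *)
Section Domain.
Variables (R : comNzRingType) (I : prime_idealr R).

Definition pquot : Type := {ideal_quot I}.

HB.instance Definition _ := GRing.ComNzRing.on pquot.

Definition pquot_unit : {pred pquot} := fun x => `[< exists y, y * x = 1 >].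
Definition pquot_inv (x : pquot) : pquot :=
  if pselect (exists y, y * x = 1) is left ex then sval (cid ex) else x.

Lemma pquot_mulVx : {in pquot_unit, left_inverse 1 pquot_inv *%R}.
Proof.
move=> x /asboolP ex; rewrite /pquot_inv; case: pselect => // ex'.
by case: cid.
Qed.

Lemma pquot_unitPl x y : y * x = 1 -> pquot_unit x.
Proof. by move=> yx; apply/asboolP; exists y. Qed.

Lemma pquot_inv_out : {in [predC pquot_unit], pquot_inv =1 id}.
Proof.
by move=> x /asboolPn nx; rewrite /pquot_inv; case: pselect.
Qed.

HB.instance Definition _ := GRing.ComNzRing_hasMulInverse.Build pquot
  pquot_mulVx pquot_unitPl pquot_inv_out.
HB.instance Definition _ := GRing.ComUnitRing_isIntegral.Build pquot
  (@Quotient.rquot_IdomainAxiom R I).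

Definition to_pquot (a : R) : pquot := \pi_({ideal_quot I}) a.
HB.instance Definition _ :=
  GRing.RMorphism.copy to_pquot (\pi_({ideal_quot I}) : R -> {ideal_quot I}).

End Domain.

Section ProjectiveSpace.
Variables (k : fieldType) (n : nat).
Implicit Types x y : hprime k n.

(* The residue field of Proj at x consists of the fractions f/g of degree 0   *)
(* in the fraction field hfrac x of k[X_0, ..., X_n]/x.                       *)
Definition hfrac x : fieldType := {fraction (pquot (hp_mem x))}.

Definition hval x : {rmorphism {mpoly k[n.+1]} -> hfrac x} :=
  @FracField.tofrac (pquot (hp_mem x)) \o @to_pquot _ (hp_mem x).

Definition hemb x : {rmorphism k -> hfrac x} := hval x \o @mpolyC n.+1 k.

Definition hreg (U : set (hprime k n)) (s : forall x, U x -> hfrac x) :=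
  forall x, U x -> exists V d (f g : {mpoly k[n.+1]}),
    [/\ open V, V x, f \is d.-homog, g \is d.-homog &
        forall y (hU : U y), V y ->
          g \notin hp_mem y /\ s y hU = hval y f / hval y g].

Lemma hval_eq0 x f : (hval x f == 0) = (f \in hp_mem x).
Proof.
rewrite /hval /= tofrac_eq0.
rewrite -(rmorph0 (@to_pquot _ (hp_mem x))) /to_pquot.
rewrite -[RHS](congr1 (fun h => h \in hp_mem x) (subr0 f)).
by rewrite Quotient.idealrBE.
Qed.

Lemma hreg_const (U : set (hprime k n)) (c : k) : open U ->
  hreg (fun x (_ : U x) => hemb x c).
Proof.
move=> Uo x Ux; exists setT, 0%N, c%:MP, 1.
split => //; [exact: openT | | exact: dhomog1 |].
  by rewrite -[c%:MP]mulr1 mul_mpolyC; apply: dhomogZ; exact: dhomog1.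
move=> y Uy _; split; first by rewrite (idealr1 (hp_mem y)).
by rewrite rmorph1 divr1.
Qed.

Lemma hreg_add (U : set (hprime k n)) (s t : forall x, U x -> hfrac x) :
  open U -> hreg s -> hreg t -> hreg (fun x hx => s x hx + t x hx).
Proof.
move=> Uo rs rt x Ux.
have [V [d [f [g [Vo Vx hf hg sE]]]]] := rs x Ux.
have [W [e [h [l [Wo Wx hh hl tE]]]]] := rt x Ux.
exists (V `&` W), (d + e)%N, (f * l + h * g), (g * l); split => //.
- exact: openI.
- by apply: dhomogD; [|rewrite addnC]; exact: dhomogM.
- exact: dhomogM.
move=> y Uy [Vy Wy]; have [gy ->] := sE y Uy Vy; have [ly ->] := tE y Uy Wy.
split; first by rewrite (prime_idealrM (hp_mem y)) negb_or gy.
by rewrite rmorphD !rmorphM addf_div ?hval_eq0.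
Qed.

Lemma hreg_mul (U : set (hprime k n)) (s t : forall x, U x -> hfrac x) :
  open U -> hreg s -> hreg t -> hreg (fun x hx => s x hx * t x hx).
Proof.
move=> Uo rs rt x Ux.
have [V [d [f [g [Vo Vx hf hg sE]]]]] := rs x Ux.
have [W [e [h [l [Wo Wx hh hl tE]]]]] := rt x Ux.
exists (V `&` W), (d + e)%N, (f * h), (g * l); split => //.
- exact: openI.
- exact: dhomogM.
- exact: dhomogM.
move=> y Uy [Vy Wy]; have [gy ->] := sE y Uy Vy; have [ly ->] := tE y Uy Wy.
split; first by rewrite (prime_idealrM (hp_mem y)) negb_or gy.
by rewrite !rmorphM mulf_div.
Qed.

Lemma hreg_res (U V : set (hprime k n)) (VU : V `<=` U)
    (s : forall x, U x -> hfrac x) : open U -> open V ->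
  hreg s -> hreg (fun x (hx : V x) => s x (VU x hx)).
Proof.
move=> _ _ rs x Vx; have [W [d [f [g [Wo Wx hf hg sE]]]]] := rs x (VU x Vx).
by exists W, d, f, g; split => // y Vy; exact: sE.
Qed.

Lemma hreg_glue (U : set (hprime k n)) (s : forall x, U x -> hfrac x) :
  open U ->
  (forall x, U x -> exists V (t : forall y, V y -> hfrac y),
     [/\ open V, V x, hreg t & forall y hU hV, s y hU = t y hV]) ->
  hreg s.
Proof.
move=> _ loc x Ux; have [V [t [Vo Vx rt st]]] := loc x Ux.
have [W [d [f [g [Wo Wx hf hg tE]]]]] := rt x Vx.
exists (V `&` W), d, f, g; split => //; first exact: openI.
by move=> y Uy [Vy Wy]; rewrite (st y Uy Vy); exact: tE.
Qed.

Definition projective_space : rspace k :=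
  RSpace hreg_const hreg_add hreg_mul hreg_res hreg_glue.

End ProjectiveSpace.

Section Phi.
Variables (k : fieldType) (q : nat).

Definition Phi_forms : 3.-tuple {mpoly k[2]} :=
  let s : {mpoly k[2]} := 'X_ord0 in let t : {mpoly k[2]} := 'X_ord_max in
  [tuple s ^+ q.+1; s ^+ q * t + s * t ^+ q; t ^+ q.+1].

(* The image under (s : t) |-> (s^(q+1) : s^q t + s t^q : t^(q+1)) of the     *)
(* point given by a homogeneous prime is its preimage under substitution of   *)
(* the three forms.                                                           *)
Definition Phi_mem (x : hprime k 1) : {mpoly k[3]} -> bool :=
  fun f => (f \mPo Phi_forms) \in hp_mem x.

Lemma Phi_memE x f : (f \in Phi_mem x) = (f \mPo Phi_forms \in hp_mem x).
Proof. by []. Qed.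

Lemma Phi_ideal x : idealr_closed (Phi_mem x).
Proof.
split; rewrite ?Phi_memE.
- by rewrite comp_mpoly0 (idealr0 (hp_mem x)).
- by rewrite comp_mpoly1 (idealr1 (hp_mem x)).
move=> a f g; rewrite !Phi_memE => fx gx.
by rewrite rmorphD rmorphM; apply: rpredD => //; exact: idealMr.
Qed.

Lemma Phi_prime x : prime_idealr_closed (Phi_mem x).
Proof.
by move=> f g; rewrite !Phi_memE rmorphM (prime_idealrM (hp_mem x)).
Qed.

Lemma Phi_forms_homog i : tnth Phi_forms i \is q.+1.-homog.
Proof.
have hX j e : ('X_j : {mpoly k[2]}) ^+ e \is e.-homog.
  rewrite -[X in X.-homog]mul1n; apply: dhomogMn.
  by rewrite dhomogX; apply/eqP; exact: mdeg1.
case: i => -[|[|[|//]]] ?; rewrite (tnth_nth 0) /=.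
- exact: hX.
- apply: dhomogD.
    by rewrite -[X in X.-homog]addn1; exact: dhomogM (hX _ q) (hX _ 1%N).
  by rewrite -[X in X.-homog]add1n; exact: dhomogM (hX _ 1%N) (hX _ q).
- exact: hX.
Qed.

Lemma Phi_homog x f d :
  f \in Phi_mem x -> pihomog mdeg d f \in Phi_mem x.
Proof.
rewrite !Phi_memE => /(@hp_homog _ _ x _ (d * q.+1)).
suff -> : pihomog mdeg (d * q.+1) (f \mPo Phi_forms)
  = pihomog mdeg d f \mPo Phi_forms by [].
have hm m : 'X_[m] \mPo Phi_forms \is (mdeg m * q.+1).-homog.
  rewrite comp_mpolyX mdegE big_distrl /=.
  elim/big_rec2: _ => [|i a b _ hb]; first exact: dhomog1.
  apply: dhomogM => //; rewrite mulnC; apply: dhomogMn.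
  exact: Phi_forms_homog.
elim/mpolyind: f => [|c m f _ _ IH]; first by rewrite !(comp_mpoly0, pihomog0).
rewrite comp_mpolyD !pihomogD comp_mpolyD IH comp_mpolyZ !linearZ /=.
rewrite pihomogX; congr (_ *: _ + _).
case: eqP => [<-|/eqP ne]; first by rewrite pihomog_dE.
by rewrite comp_mpoly0 (pihomog_ne0 _ (hm m)) // eqn_pmul2r.
Qed.

Lemma Phi_relevant x : exists i : 'I_3, 'X_i \notin Phi_mem x.
Proof.
have hX j e : 'X_j ^+ e.+1 \in hp_mem x -> 'X_j \in hp_mem x.
  elim: e => // e IH; rewrite exprS (prime_idealrM (hp_mem x)).
  by case/orP => // /IH.
have [i] := hp_relevant x; case: i => -[|[|//]] hi nx.
- exists ord0; apply: contra nx; rewrite !Phi_memE comp_mpolyXU /=.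
  by move/hX; congr (is_true ('X_ _ \in _)); exact: val_inj.
- exists ord_max; apply: contra nx; rewrite !Phi_memE comp_mpolyXU /=.
  by move/hX; congr (is_true ('X_ _ \in _)); exact: val_inj.
Qed.

Definition Phi (x : projective_space k 1) : projective_space k 2 :=
  HPrime (Phi_ideal x) (@Phi_prime x) (@Phi_homog x) (Phi_relevant x).

End Phi.

(* Main.v *)
Require Import Defs.
From mathcomp Require Import all_boot all_order all_algebra all_field.
From mathcomp Require Import ring zify.
From mathcomp Require Import classical_sets boolp topology_structure.

(* With z = s / t, put w = z and w' = z ^ q: the map Phi has as coordinates the
   elementary symmetric functions of w and w'. Frobenius being f (z) ^ q =
   f (z ^ q), the norm f ^ (q + 1) of a form f is symmetric, hence a form in the
   coordinates of Phi; so Phi is a homeomorphism onto its image. The ring k[z] is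
   generated by 1 and z over the ring R of these coordinates, and the conductor
   c = (z ^ q ^ 2 - z) / (z ^ q - z), the product of the monic irreducible
   quadratics, satisfies c k[z] <= R. Away from the zeros of c, R and k[z] agree
   locally; at a zero of c, which is a point of degree 2, write f = a + b z with
   a, b in R: if the value of f lies in k then b vanishes there, so that b z lies
   locally in c k[z], because c has simple zeros. *)

Set Implicit Arguments.
Unset Strict Implicit.
Unset Printing Implicit Defensive.

Import GRing.Theory.
Local Open Scope ring_scope.

(** * Symmetric functions in two variables *)

Section SymmetricFunctions.
Variable R : comNzRingType.
Implicit Types (a b : R) (n : nat).

(** The complete homogeneous symmetric polynomial, the sum of [a ^+ i * b ^+ (n - i)] over
    [i <= n]. *)
Fixpoint hsym a b n : R := if n is m.+1 then b ^+ n + a * hsym a b m else 1.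

(** The coefficients here and in [power_sumSS] are [a + b] and [a * b], so induction expresses both
    families through the elementary symmetric functions. *)
Lemma hsymSS a b n :
  hsym a b n.+2 = (a + b) * hsym a b n.+1 - a * b * hsym a b n.
Proof. by rewrite /= [b ^+ n.+2]exprS; ring. Qed.

Lemma hsym_sub a b n : (b - a) * hsym a b n = b ^+ n.+1 - a ^+ n.+1.
Proof.
elim: n => [|n IH] /=; first by rewrite !expr1 mulr1.
by rewrite mulrDr mulrCA IH [b ^+ n.+2]exprS [a ^+ n.+2]exprS; ring.
Qed.

Lemma hsym_diag a n : hsym a a n = a ^+ n *+ n.+1.
Proof.
by elim: n => [|n IH] //=; rewrite IH mulrnAr -exprS -mulrS.
Qed.

Lemma power_sumSS a b n : a ^+ n.+2 + b ^+ n.+2 =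
  (a + b) * (a ^+ n.+1 + b ^+ n.+1) - a * b * (a ^+ n + b ^+ n).
Proof. by rewrite !exprS; ring. Qed.

(** The left side is the cross term of the norm [f ^+ q.+1] between two monomials of equal degree.
    Their common part [x ^+ a * y ^+ d] contributes its norm; what remains is a power sum. *)
Lemma cross_monomialE (q a d k : nat) (x y : R) :
  (x ^+ a * y ^+ (d + k)) * (x ^+ (a + k) * y ^+ d) ^+ q
    + (x ^+ a * y ^+ (d + k)) ^+ q * (x ^+ (a + k) * y ^+ d)
  = (x ^+ q.+1) ^+ a * (y ^+ q.+1) ^+ d
    * ((x * y ^+ q) ^+ k + (x ^+ q * y) ^+ k).
Proof.
rewrite !exprMn ![(_ ^+ _) ^+ q]exprAC !exprS !exprMn !exprD; ring.
Qed.

End SymmetricFunctions.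

(** * Binary forms and partial derivatives *)

Lemma ord2_neq (i j : 'I_2) : i != j ->
  (i = ord0 /\ j = ord_max) \/ (i = ord_max /\ j = ord0).
Proof.
case: i => [[|[|//]] hi]; case: j => [[|[|//]] hj] // _; [left | right];
  by split; exact: val_inj.
Qed.

Section BinaryForms.
Variables (R : comNzRingType) (i j : 'I_2).
Hypothesis ij : i != j.

Lemma mpolyX_binary (m : 'X_{1..2}) :
  'X_[m] = 'X_i ^+ m i * 'X_j ^+ m j :> {mpoly R[2]}.
Proof.
rewrite mpolyXE_id (bigD1 i) //= (bigD1 j) 1?eq_sym //= big_pred0 ?mulr1 //.
move=> k; move: ij; case: i => [[|[|//]] ?]; case: j => [[|[|//]] ?];
  by case: k => [[|[|//]] ?].
Qed.

Lemma mdeg_binary (m : 'X_{1..2}) : mdeg m = (m i + m j)%N.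
Proof.
rewrite mdegE (bigD1 i) //= (bigD1 j) 1?eq_sym //= big_pred0 ?addn0 //.
move=> k; move: ij; case: i => [[|[|//]] ?]; case: j => [[|[|//]] ?];
  by case: k => [[|[|//]] ?].
Qed.

Lemma dhomog_ind (P : {mpoly R[2]} -> Prop) d :
    P 0 -> (forall f g, P f -> P g -> P (f + g)) ->
    (forall c f, P f -> P (c *: f)) ->
    (forall a b, (a + b)%N = d -> P ('X_i ^+ a * 'X_j ^+ b)) ->
  forall f, f \is d.-homog -> P f.
Proof.
move=> P0 PD PZ PX f /dhomogP fd; rewrite [f]mpolyE big_seq.
elim/big_ind: _ => // m /fd md; apply: PZ; rewrite mpolyX_binary; apply: PX.
by rewrite -mdeg_binary.
Qed.

Lemma dhomogXn n (k : 'I_n) e : ('X_k : {mpoly R[n]}) ^+ e \is e.-homog.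
Proof.
rewrite -[X in X.-homog]mul1n; apply: dhomogMn.
by rewrite dhomogX; apply/eqP; exact: mdeg1.
Qed.

Lemma dhomogX1 n (k : 'I_n) : ('X_k : {mpoly R[n]}) \is 1.-homog.
Proof. exact: (dhomogXn k 1). Qed.

End BinaryForms.

Lemma mderiv_expr (R : comNzRingType) n (k : 'I_n) (f : {mpoly R[n]}) m :
  (f ^+ m.+1)^`M(k) = (f ^+ m * f^`M(k)) *+ m.+1.
Proof.
elim: m => [|m IH]; first by rewrite expr1 mul1r.
by rewrite exprS mderivM IH mulrnAr mulrA -exprS mulrC -mulrS.
Qed.

Lemma mderivXj (R : comNzRingType) n (k l : 'I_n) :
  ('X_l : {mpoly R[n]})^`M(k) = (l == k)%:R.
Proof.
rewrite mderivX mnm1E; case: eqP => [->|]; last by rewrite scale0r.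
have -> : (U_(k) - U_(k) = 0 :> 'X_{1..n})%MM.
  by apply/mnmP => a; rewrite mnmBE mnm0E subnn.
by rewrite mpolyX0 scale1r.
Qed.

(** * The graded ring generated by the coordinates of Phi *)

Section Forms.
Variables (F : fieldType) (q : nat).
Notation S := {mpoly F[2]}.
Implicit Types (f g : S) (d : nat).

(** The index [d] is the degree of [G]; as a binary form, [f] has degree [d * q.+1]. *)
Definition Phi_image d f :=
  exists2 G : {mpoly F[3]}, G \is d.-homog & f = G \mPo Phi_forms F q.

Lemma Phi_image0 d : Phi_image d 0.
Proof. by exists 0; [exact: dhomog0 | rewrite comp_mpoly0]. Qed.

Lemma Phi_image1 : Phi_image 0 1.
Proof. by exists 1; [exact: dhomog1 | rewrite comp_mpoly1]. Qed.

Lemma Phi_imageD d f g : Phi_image d f -> Phi_image d g -> Phi_image d (f + g).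
Proof.
by move=> [G hG ->] [H hH ->]; exists (G + H); rewrite ?comp_mpolyD ?dhomogD.
Qed.

Lemma Phi_imageZ c d f : Phi_image d f -> Phi_image d (c *: f).
Proof. by move=> [G hG ->]; exists (c *: G); rewrite ?comp_mpolyZ ?dhomogZ. Qed.

Lemma Phi_imageN d f : Phi_image d f -> Phi_image d (- f).
Proof. by rewrite -scaleN1r; exact: Phi_imageZ. Qed.

Lemma Phi_imageB d f g : Phi_image d f -> Phi_image d g -> Phi_image d (f - g).
Proof. by move=> hf hg; apply: Phi_imageD => //; exact: Phi_imageN. Qed.

Lemma Phi_imageM d e f g :
  Phi_image d f -> Phi_image e g -> Phi_image (d + e) (f * g).
Proof.
by move=> [G hG ->] [H hH ->]; exists (G * H); rewrite ?rmorphM ?dhomogM.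
Qed.

Lemma Phi_image_exp d f n : Phi_image d f -> Phi_image (d * n) (f ^+ n).
Proof.
by move=> [G hG ->]; exists (G ^+ n); rewrite ?rmorphXn ?dhomogMn.
Qed.

Lemma Phi_image_exp1 f n : Phi_image 1 f -> Phi_image n (f ^+ n).
Proof. by move=> /(@Phi_image_exp _ _ n); rewrite mul1n. Qed.

Lemma Phi_image_hsym a b n : Phi_image 1 (a + b) -> Phi_image 2 (a * b) ->
  Phi_image n (hsym a b n).
Proof.
move=> hs hp; have [n2 lt_n] := ubnP n; elim: n2 n lt_n => // m IH [|[|n]] lt_n.
- exact: Phi_image1.
- by rewrite /= expr1 mulr1 addrC.
rewrite hsymSS; apply: Phi_imageB.
  by apply: (Phi_imageM hs); apply: IH.
by apply: (Phi_imageM hp); apply: IH; apply: ltnW.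
Qed.

Lemma Phi_image_power_sum a b n : Phi_image 1 (a + b) -> Phi_image 2 (a * b) ->
  Phi_image n (a ^+ n + b ^+ n).
Proof.
move=> hs hp; have [n2 lt_n] := ubnP n; elim: n2 n lt_n => // m IH [|[|n]] lt_n.
- by apply: Phi_imageD; exact: Phi_image1.
- by rewrite !expr1.
rewrite power_sumSS; apply: Phi_imageB.
  by apply: (Phi_imageM hs); apply: IH.
by apply: (Phi_imageM hp); apply: IH; apply: ltnW.
Qed.

Lemma Phi_image_form (k : 'I_3) : Phi_image 1 (tnth (Phi_forms F q) k).
Proof.
by exists 'X_k; [exact: dhomogX1 | rewrite comp_mpolyXU -tnth_nth].
Qed.

Lemma Phi_image_dhomog d f : Phi_image d f -> f \is (d * q.+1).-homog.
Proof.
move=> [G /dhomogP hG ->]; rewrite comp_mpolyEX big_seq.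
apply: rpred_sum => m /hG /= <-; apply: dhomogZ; rewrite comp_mpolyX mdegE.
rewrite big_distrl /=; elim/big_rec2: _ => [|k a b _ hb]; first exact: dhomog1.
apply: dhomogM => //; rewrite mulnC; apply: dhomogMn.
exact: Phi_forms_homog.
Qed.

Section Chart.
Variables i j : 'I_2.
Hypothesis ij : i != j.
Notation u := ('X_i : S).
Notation t := ('X_j : S).
Notation P := (u ^+ q.+1).
Notation T := (t ^+ q.+1).
Notation w := (u * t ^+ q).
Notation w' := (u ^+ q * t).

Lemma Phi_forms_chart : [/\ Phi_image 1 P, Phi_image 1 T & Phi_image 1 (w + w')].
Proof.
have h0 : Phi_image 1 ('X_ord0 ^+ q.+1) := Phi_image_form ord0.
have h1 : Phi_image 1 ('X_ord0 ^+ q * 'X_ord_max + 'X_ord0 * 'X_ord_max ^+ q).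
  exact: Phi_image_form (Ordinal (isT : 1 < 3)%N).
have h2 : Phi_image 1 ('X_ord_max ^+ q.+1) := Phi_image_form ord_max.
case: (ord2_neq ij) => -[-> ->]; split => //; first by rewrite addrC.
by rewrite mulrC [X in _ + X]mulrC.
Qed.


Lemma Phi_image_ww' : Phi_image 2 (w * w').
Proof.
have [hP hT _] := Phi_forms_chart.
rewrite (_ : w * w' = P * T); first exact: (Phi_imageM hP hT).
by rewrite !exprS; ring.
Qed.

(** The sum is symmetric in the two monomials, which allows [a <= c]; it then factors as
    [P ^+ a * T ^+ d] times the power sum of [w] and [w'] of exponent [c - a]. *)
Lemma Phi_image_monomial_cross a b c d : (a + b = c + d)%N ->
  Phi_image (a + b) ((u ^+ a * t ^+ b) * (u ^+ c * t ^+ d) ^+ q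
                     + (u ^+ a * t ^+ b) ^+ q * (u ^+ c * t ^+ d)).
Proof.
wlog le_ac : a b c d / (a <= c)%N => [hw | abcd].
  move=> abcd; have [le_ac | lt_ca] := leqP a c; first exact: hw.
  rewrite abcd addrC [X in X + _]mulrC [X in _ + X]mulrC.
  exact: hw (ltnW lt_ca) (esym abcd).
have [hP hT hS] := Phi_forms_chart.
have [k ck] : exists k, c = (a + k)%N by exists (c - a)%N; rewrite subnKC.
have bk : b = (d + k)%N by lia.
rewrite {}ck {}bk {abcd le_ac}.
rewrite cross_monomialE addnA; apply: Phi_imageM.
  by apply: Phi_imageM; exact: Phi_image_exp1.
by apply: Phi_image_power_sum => //; exact: Phi_image_ww'.
Qed.

(** The homogeneous version of R + R z inside k[z]: as [w] is z times [T], its coefficient has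
    degree one less. *)
Definition Phi_span d f := exists A B,
  [/\ Phi_image d.+1 A, Phi_image d B & f = A + B * w].

Lemma Phi_spanM_w d f : Phi_span d f -> Phi_span d.+1 (w * f).
Proof.
have [hP hT hS] := Phi_forms_chart.
(* [w] is a root of [X ^+ 2 - (w + w') * X + w * w'], which eliminates [w ^+ 2]. *)
move=> [A [B [hA hB ->]]]; exists (- (B * (w * w'))), (A + B * (w + w')).
split; last by ring.
- by apply: Phi_imageN; rewrite -addn2; exact: (Phi_imageM hB Phi_image_ww').
- by apply: Phi_imageD => //; rewrite -addn1; exact: Phi_imageM.
Qed.

Lemma Phi_span_wT a b : Phi_span (a + b) (w ^+ a * T ^+ b.+1).
Proof.
have [hP hT hS] := Phi_forms_chart.
elim: a => [|a IH]; last by rewrite exprS -mulrA; exact: Phi_spanM_w.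
exists (T ^+ b.+1), 0; split; rewrite ?expr0 ?mul1r ?mul0r ?addr0 //.
- exact: Phi_image_exp1.
- exact: Phi_image0.
Qed.

(** Multiplication by a power of [T] turns [u ^+ a] into [w ^+ a]. The exponent is chosen to leave a
    positive power of [T] even for the largest [a], namely [d * q.+1]. *)
Lemma Phi_span_dhomog d f : f \is (d * q.+1).-homog ->
  Phi_span (d * q.+1) (T ^+ (d * q).+1 * f).
Proof.
move: f; apply: (dhomog_ind ij) => [|f g [A [B [hA hB hf]]] [A' [B' [hA' hB' hg]]]|
    c f [A [B [hA hB hf]]]|a b abd].
- by exists 0, 0; split; rewrite ?mulr0 ?mul0r ?addr0 //; exact: Phi_image0.
- exists (A + A'), (B + B'); split; try exact: Phi_imageD.
  by rewrite mulrDr hf hg; ring.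
- exists (c *: A), (c *: B); split; try exact: Phi_imageZ.
  by rewrite -scalerAr hf scalerDr scalerAl.
have a_le : (a <= d * q.+1)%N by rewrite -abd leq_addr.
have -> : T ^+ (d * q).+1 * (u ^+ a * t ^+ b)
    = w ^+ a * T ^+ (d * q.+1 - a).+1.
  rewrite exprMn mulrCA -mulrA; congr (_ * _); rewrite -!exprM -!exprD.
  by congr (_ ^+ _); nia.
by rewrite -{1}(subnKC a_le); exact: Phi_span_wT.
Qed.

End Chart.
End Forms.

(** * Frobenius and norms of forms over a finite field *)

Section FiniteField.
Variables (p e q : nat) (F : finFieldType).
Hypotheses (hp : prime p) (he : (0 < e)%N) (hq : q = (p ^ e)%N) (hF : #|F| = q).
Notation S := {mpoly F[2]}.

Lemma q_gt0 : (0 < q)%N.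
Proof. by rewrite hq expn_gt0 prime_gt0. Qed.

Lemma pchar_F : p \in [pchar F].
Proof. by apply: (@card_finPcharP F p e); rewrite ?hF. Qed.

(** The morphism [h] carries the characteristic of [F] over to [R]. *)
Lemma exprD_q (R : comNzRingType) (h : {rmorphism F -> R}) (x y : R) :
  (x + y) ^+ q = x ^+ q + y ^+ q.
Proof.
apply: exprDn_pchar; rewrite hq pnatX pnatE // (rmorph_pchar h) //.
exact: pchar_F.
Qed.

Lemma natr_q (R : comNzRingType) (h : {rmorphism F -> R}) : q%:R = 0 :> R.
Proof.
rewrite hq natrX (pcharf0 (rmorph_pchar h pchar_F)) expr0n.
by rewrite eqn0Ngt he.
Qed.

Lemma scaler_q (c : F) (f : S) : (c *: f) ^+ q = c *: f ^+ q.
Proof. by rewrite exprZn -{1}hF expf_card. Qed.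

(** Over [F] the polynomial X^q - X is the product of all X - c, so its roots in any extension come
    from [F]. *)
Lemma expr_q_const (L : fieldType) (h : {rmorphism F -> L}) (x : L) :
  x ^+ q = x -> exists c, x = h c.
Proof.
move=> xq.
have : (map_poly h ('X^q - 'X)).[x] = 0.
  by rewrite rmorphB /= map_polyXn map_polyX hornerD hornerN hornerXn hornerX xq subrr.
rewrite -hF finField_genPoly rmorph_prod /= horner_prod => /eqP.
rewrite prodf_seq_eq0 => /hasP[c _] /=.
rewrite rmorphB /= map_polyX map_polyC hornerXsubC subr_eq0 => /eqP ->.
by exists c.
Qed.

(* Frobenius exchanges the two branches: f ^+ q = f (u ^+ q) (t ^+ q), so that
   f * f ^+ q is symmetric in (u, t) and (u ^+ q, t ^+ q). *)
Lemma Phi_image_norm d (f : S) : f \is d.-homog -> Phi_image q d (f ^+ q.+1).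
Proof.
have ij : (ord0 : 'I_2) != ord_max by [].
move=> hf.
(* The norm is not additive: that of [f + g] has the cross term [f * g ^+ q + f ^+ q * g], so the
   induction carries the cross terms along. *)
suff [] : [/\ f \is d.-homog, Phi_image q d (f ^+ q.+1) &
  forall g : S, g \is d.-homog -> Phi_image q d (f * g ^+ q + f ^+ q * g)] by [].
move: f hf; apply: (dhomog_ind ij) => [|f g [hf nf cf] [hg ng cg]|c f [hf nf cf]|a b abd].
- split; first exact: dhomog0.
    by rewrite exprS mul0r; exact: Phi_image0.
  move=> g _; rewrite expr0n eqn0Ngt q_gt0 !mul0r addr0; exact: Phi_image0.
- split; first exact: dhomogD.
    rewrite exprS (exprD_q (@mpolyC 2 F)).
    rewrite (_ : _ * _ = f ^+ q.+1 + g ^+ q.+1 + (f * g ^+ q + f ^+ q * g)).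
      by apply: Phi_imageD; [exact: Phi_imageD | exact: cf].
    by rewrite !exprS; move: (f ^+ q) (g ^+ q) => f' g'; ring.
  move=> h hh; rewrite (exprD_q (@mpolyC 2 F)).
  rewrite (_ : _ + _ = (f * h ^+ q + f ^+ q * h) + (g * h ^+ q + g ^+ q * h)).
    by apply: Phi_imageD; [exact: cf | exact: cg].
  by move: (h ^+ q) (f ^+ q) (g ^+ q) => h' f' g'; ring.
- split; first exact: dhomogZ.
    by rewrite exprS scaler_q -scalerAl -scalerAr -exprS; do 2!apply: Phi_imageZ.
  by move=> g hg; rewrite scaler_q -!scalerAl -scalerDr; apply: Phi_imageZ; exact: cf.
split.
- by rewrite -abd; apply: dhomogM; exact: dhomogXn.
- rewrite exprMn -!exprM mulnC [(b * _)%N]mulnC !exprM -abd.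
  have [hP hT _] := Phi_forms_chart F q ij.
  by apply: Phi_imageM; exact: Phi_image_exp1.
apply: (dhomog_ind ij) => [|f g cf cg|c f cf|a' b' abd'].
- by rewrite expr0n eqn0Ngt q_gt0 !mulr0 addr0; exact: Phi_image0.
- rewrite (exprD_q (@mpolyC 2 F)) !mulrDr addrACA; exact: Phi_imageD.
- by rewrite scaler_q -!scalerAr -scalerDr; exact: Phi_imageZ.
- by rewrite -abd; apply: Phi_image_monomial_cross => //; rewrite abd.
Qed.

End FiniteField.

Lemma rmorph_hsym (R R' : comNzRingType) (h : {rmorphism R -> R'}) (a b : R) n :
  h (hsym a b n) = hsym (h a) (h b) n.
Proof.
by elim: n => [|n IH] /=; rewrite ?rmorph1 // rmorphD rmorphM rmorphXn IH.
Qed.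

Lemma hsym_pred (R : comNzRingType) (a b : R) n : (0 < n)%N ->
  hsym a b n = b ^+ n + a * hsym a b n.-1.
Proof. by case: n. Qed.

(** * Division by a quadratic form *)

Section QuadraticRemainder.
Variables (F : fieldType) (i j : 'I_2).
Hypothesis ij : i != j.
Notation S := {mpoly F[2]}.
Notation u := ('X_i : S).
Notation t := ('X_j : S).

(** The homogenized characteristic polynomial of [z = u / t] when [a] is the trace [z + z ^+ q] and
    [b] the norm [z ^+ q.+1]. *)
Definition quad (a b : F) : S := u ^+ 2 - a *: (u * t) + b *: t ^+ 2.

(** Division with remainder works because [quad] is monic in [u]. The factor [t ^+ 2] keeps the
    quotient in degree [d], with no subtraction of degrees. *)
Lemma quad_div a b d (f : S) : f \is d.-homog -> exists g c c',
  g \is d.-homog /\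
  t ^+ 2 * f = quad a b * g + (c *: u + c' *: t) * t ^+ d.+1.
Proof.
move: f; apply: (dhomog_ind ij) =>
  [|f g [f1 [c1 [c2 [hf E1]]]] [g1 [c3 [c4 [hg E2]]]]|c f|m n].
- exists 0, 0, 0; split; first exact: dhomog0.
  by rewrite !mulr0 !scale0r addr0 mul0r addr0.
- exists (f1 + g1), (c1 + c3), (c2 + c4); split; first exact: dhomogD.
  rewrite mulrDr E1 E2 !scalerDl; move: (quad a b) (t ^+ _) => A B.
  by move: (c1 *: u) (c2 *: t) (c3 *: u) (c4 *: t) => C1 C2 C3 C4; ring.
- move=> [g [c1 [c2 [hg E]]]]; exists (c *: g), (c * c1), (c * c2).
  split; first exact: dhomogZ.
  by rewrite -scalerAr E -!scalerA -scalerDr -scalerAr -scalerAl scalerDr.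
elim: m n d => [|m IH] n d mn.
  exists 0, 0, 1; split; first exact: dhomog0.
  by rewrite -mn add0n expr0 mulr0 !add0r scale0r scale1r mul1r add0r -!exprS -exprD.
have := IH n d.-1; case: d mn => // d [mn] /(_ mn) [g [c1 [c2 [hg E]]]].
(* Multiplying the previous identity by [u] produces [c1 *: u ^+ 2], and [u ^+ 2] is [quad a b] plus
   [a *: (u * t)] minus [b *: t ^+ 2]. *)
exists (g * u + c1 *: t ^+ d.+1), (c1 * a + c2), (- (c1 * b)); split.
  apply: dhomogD; last by apply: dhomogZ; exact: dhomogXn.
  by rewrite -[X in X.-homog]addn1; apply: dhomogM => //; exact: dhomogX1.
have -> : t ^+ 2 * (u ^+ m.+1 * t ^+ n) = u * (t ^+ 2 * (u ^+ m * t ^+ n)).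
  by rewrite [u ^+ m.+1]exprS; ring.
rewrite E /quad -!mul_mpolyC [t ^+ d.+2]exprS !mpolyCD !mpolyCN !mpolyCM.
by ring.
Qed.

End QuadraticRemainder.

(** * The conductor *)

Section Conductor.
Variables (p e q : nat) (F : finFieldType).
Hypotheses (hp : prime p) (he : (0 < e)%N) (hq : q = (p ^ e)%N) (hF : #|F| = q).
Variables i j : 'I_2.
Hypothesis ij : i != j.
Notation S := {mpoly F[2]}.
Notation u := ('X_i : S).
Notation t := ('X_j : S).
Notation P := (u ^+ q.+1).
Notation T := (t ^+ q.+1).
Notation w := (u * t ^+ q).
Notation w' := (u ^+ q * t).

(* t^(q^2 - 1) times the dehomogenized product of the monic irreducible
   quadratics, (z^(q^2) - z) / (z^q - z) with z = u / t. *)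
Definition conductor : S := T ^+ q.-1 + hsym w w' q.-1.

Lemma conductor_image : Phi_image q q.-1 conductor.
Proof.
have [hP hT hS] := Phi_forms_chart F q ij.
apply: Phi_imageD; first exact: Phi_image_exp1.
by apply: Phi_image_hsym => //; exact: Phi_image_ww'.
Qed.

(** Frobenius carries the branch [w] to the branch [w'], up to a power of [T]. *)
Lemma w_expr_q : w ^+ q = T ^+ q.-1 * w'.
Proof.
have q0 := q_gt0 hp hq.
rewrite exprMn mulrCA; congr (_ * _); rewrite -!exprM -exprSr.
by congr (_ ^+ _); nia.
Qed.

(** The telescoping identity [hsym_sub] gives c (z^q - z) = z^(q^2) - z in homogeneous form. *)
Lemma conductor_sub : conductor * (w' - w) = (u ^+ q) ^+ q * t ^+ q - T ^+ q.-1 * w.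
Proof.
have q0 := q_gt0 hp hq.
rewrite mulrDl [hsym _ _ _ * _]mulrC hsym_sub prednK // w_expr_q -exprMn.
by move: w w' (T ^+ _) (_ ^+ q) => A B C D; ring.
Qed.

Lemma conductor_w_image : Phi_image q q (conductor * w).
Proof.
have [hP hT hS] := Phi_forms_chart F q ij.
have q0 := q_gt0 hp hq.
(* [hsym w w' q] is [w' ^+ q + w * hsym w w' q.-1], and [(w + w') ^+ q] is
   [T ^+ q.-1 * w' + w' ^+ q]; the difference cancels the terms without a factor [w]. *)
rewrite (_ : _ * _ = T ^+ q.-1 * (w + w') + hsym w w' q - (w + w') ^+ q).
  apply: Phi_imageB; last exact: Phi_image_exp1.
  apply: Phi_imageD; last by apply: Phi_image_hsym => //; exact: Phi_image_ww'.
  rewrite -[X in Phi_image _ X]prednK // -addn1; apply: Phi_imageM => //.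
  exact: Phi_image_exp1.
rewrite (exprD_q hp hq hF (@mpolyC 2 F)) w_expr_q /conductor.
rewrite (hsym_pred w w' q0).
by move: w w' (T ^+ _) (_ ^+ q) (hsym _ _ _) => A B C D E; ring.
Qed.

Lemma conductor_w2_image : Phi_image q q.+1 (conductor * w * w).
Proof.
have [hP hT hS] := Phi_forms_chart F q ij.
rewrite (_ : _ * w = conductor * w * (w + w') - conductor * (w * w')); last first.
  by move: conductor w w' => A B C; ring.
apply: Phi_imageB; first by rewrite -addn1; exact: Phi_imageM conductor_w_image hS.
have -> : q.+1 = (q.-1 + 2)%N by have := q_gt0 hp hq; lia.
by apply: (Phi_imageM conductor_image); exact: Phi_image_ww'.
Qed.

(** Only [conductor * w] and [conductor * w * w] occur, and both lie in the image; this is the form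
    in which c k[z] <= R is used. *)
Lemma conductorM_span d f : Phi_span q i j d f ->
  Phi_image q (d + q.+1) (conductor * w * f).
Proof.
move=> [A [B [hA hB ->]]].
rewrite (_ : _ * (_ + _) = A * (conductor * w) + B * (conductor * w * w)).
  apply: Phi_imageD; last exact: Phi_imageM hB conductor_w2_image.
  by rewrite addnS -addSn; exact: Phi_imageM hA conductor_w_image.
by move: conductor w => C D; ring.
Qed.

(** * Values at a point where [t] does not vanish *)

Section Evaluation.
Variables (L : fieldType) (v : {rmorphism S -> L}).
Hypothesis vt : v t != 0.
Notation z := (v u / v t).
Variable cst : {rmorphism F -> L}.
Hypothesis cstE : forall c, v c%:MP = cst c.

Lemma eval_w : v w = z * v T.
Proof. by rewrite rmorphM !rmorphXn exprS; field. Qed.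

Lemma eval_w' : v w' = z ^+ q * v T.
Proof.
by rewrite rmorphM !rmorphXn exprS expr_div_n; field; rewrite expf_neq0.
Qed.

Lemma eval_P : v P = z ^+ q.+1 * v T.
Proof. by rewrite !rmorphXn expr_div_n divfK // expf_neq0. Qed.

(** The first claim is read off [conductor_sub]. If [z ^+ q = z], then [w] and [w'] take the same
    value, so [hsym] becomes a multiple of q and vanishes; the conductor is then a power of [T],
    hence nonzero. *)
Lemma conductor_root : v conductor = 0 ->
  (z ^+ q) ^+ q = z /\ z ^+ q != z.
Proof.
have vT : v T != 0 by rewrite rmorphXn expf_neq0.
have q0 := q_gt0 hp hq.
move=> vC; split.
  have := congr1 v conductor_sub; rewrite rmorphM vC mul0r => /esym/eqP.
  rewrite rmorphB subr_eq0 !rmorphM !rmorphXn => /eqP E.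
  rewrite !expr_div_n.
  have E' : (v u ^+ q) ^+ q = (v t ^+ q.+1) ^+ q.-1 * v u.
    by apply: (mulIf (expf_neq0 q vt)); rewrite E mulrA.
  rewrite E'; apply: (mulIf (expf_neq0 q (expf_neq0 q vt))).
  rewrite divfK ?expf_neq0 // mulrAC -mulrA mulrC; congr (_ * _).
  apply: (mulIf vt); rewrite divfK // -!exprM -exprSr; congr (_ ^+ _); nia.
apply/eqP => zq; case/eqP: (expf_neq0 q.-1 vT).
move: vC; rewrite /conductor rmorphD rmorphXn rmorph_hsym eval_w eval_w' zq.
by rewrite hsym_diag prednK // -mulr_natl (natr_q hp he hq hF cst) mul0r addr0.
Qed.

(** Frobenius exchanges [z] and [z ^+ q], hence fixes their sum and product. *)
Lemma quad_root_cst : (z ^+ q) ^+ q = z ->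
  (exists a, z + z ^+ q = cst a) /\ (exists b, z ^+ q.+1 = cst b).
Proof.
move=> zqq; split; apply: (expr_q_const hF).
  by rewrite (exprD_q hp hq hF cst) zqq addrC.
by rewrite exprS exprMn zqq mulrC.
Qed.

Lemma quad_root a b : z + z ^+ q = cst a -> z ^+ q.+1 = cst b ->
  v (quad i j a b) = 0.
Proof.
move=> za zb; rewrite /quad rmorphD rmorphB -!mul_mpolyC !rmorphM.
rewrite !cstE -za -zb exprS.
by move: (z ^+ q) => y; field.
Qed.

(** Divided by [T], the coordinates of Phi take as values the norm of z, its trace and 1, all of
    them constants. *)
Lemma Phi_image_value d f :
    (exists a, z + z ^+ q = cst a) -> (exists b, z ^+ q.+1 = cst b) ->
  Phi_image q d f -> exists c, v f = cst c * v T ^+ d.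
Proof.
move=> [a za] [b zb] [G /dhomogP hG ->].
have hk (k : 'I_3) : exists c, v (tnth (Phi_forms F q) k) = cst c * v T.
  have eP : v P = cst b * v T by rewrite eval_P zb.
  have eT : v T = cst 1 * v T by rewrite rmorph1 mul1r.
  have eS : v (w + w') = cst a * v T by rewrite rmorphD eval_w eval_w' -za mulrDl.
  have h0 : exists c, v ('X_ord0 ^+ q.+1) = cst c * v T.
    by case: (ord2_neq ij) eP eT => -[-> ->] eP eT; [exists b | exists 1].
  have h1 : exists c, v ('X_ord0 ^+ q * 'X_ord_max + 'X_ord0 * 'X_ord_max ^+ q)
      = cst c * v T.
    exists a; rewrite -eS; case: (ord2_neq ij) => -[-> ->]; first by rewrite addrC.
    by rewrite mulrC [X in _ + X]mulrC.
  have h2 : exists c, v ('X_ord_max ^+ q.+1) = cst c * v T.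
    by case: (ord2_neq ij) eP eT => -[-> ->] eP eT; [exists 1 | exists b].
  by case: k => -[|[|[|//]]] ?; rewrite (tnth_nth 0).
rewrite comp_mpolyEX big_seq.
elim/big_ind: _ => [|f1 f2 [c1 e1] [c2 e2]|m /hG /= <-].
- by exists 0; rewrite !rmorph0 mul0r.
- by exists (c1 + c2); rewrite !rmorphD e1 e2 mulrDl.
suff [c ec] : exists c, v ('X_[m] \mPo Phi_forms F q) = cst c * v T ^+ mdeg m.
  by exists (G@_m * c); rewrite -mul_mpolyC !rmorphM ec cstE mulrA.
rewrite comp_mpolyX mdegE; elim/big_rec2: _ => [|k n f1 _ [c1 e1]].
  by exists 1; rewrite !rmorph1 mul1r.
have [c2 e2] := hk k; exists (c2 ^+ m k * c1).
by rewrite !rmorphM !rmorphXn e1 e2 !rmorphXn exprMn exprD mulrACA.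
Qed.

Lemma dhomog_value d f :
    (exists a, z + z ^+ q = cst a) -> (exists b, z ^+ q.+1 = cst b) ->
  f \is d.-homog -> exists c c', v f = (cst c * z + cst c') * v t ^+ d.
Proof.
move=> [a za] [b zb] /(quad_div ij a b) [g [c [c' [_ E]]]]; exists c, c'.
have := congr1 v E; rewrite rmorphD [v (quad _ _ _ _ * g)]rmorphM (quad_root za zb) mul0r add0r.
rewrite !rmorphM !rmorphXn rmorphD -!mul_mpolyC !rmorphM !cstE => E'.
apply: (mulfI (expf_neq0 2 vt)); rewrite E' exprS.
by field.
Qed.

(** Multiplying through by [g ^+ q] makes the denominator a norm, whose value is a constant times a
    power of [T]; the numerator is reduced modulo [quad]. *)
Lemma frac_value d (f g : S) :
    (exists a, z + z ^+ q = cst a) -> (exists b, z ^+ q.+1 = cst b) ->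
    f \is d.-homog -> g \is d.-homog -> v g != 0 ->
  exists c c', v f / v g = cst c' + cst c * z.
Proof.
move=> za zb hf hg vg.
have [c0 e0] := Phi_image_value za zb (Phi_image_norm hp hq hF hg).
have hfg : f * g ^+ q \is (d * q.+1).-homog.
  by rewrite mulnS; apply: dhomogM => //; exact: dhomogMn.
have [c1 [c2 e12]] := dhomog_value za zb hfg.
have ec0 : cst c0 != 0.
  have : v (g ^+ q.+1) != 0 by rewrite rmorphXn expf_neq0.
  by rewrite e0; apply: contraNneq => ->; rewrite mul0r.
exists (c1 / c0), (c2 / c0).
have -> : v f / v g = v (f * g ^+ q) / v (g ^+ q.+1).
  by rewrite rmorphM !rmorphXn exprS; field; rewrite vg expf_neq0.
rewrite e0 e12 rmorphXn -exprM [(q.+1 * d)%N]mulnC !fmorph_div.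
by field; rewrite ec0 vt expf_neq0.
Qed.

Lemma cst_expr_q c : cst c ^+ q = cst c.
Proof. by rewrite -rmorphXn -{1}hF expf_card. Qed.

(** A nontrivial relation would make [z] a constant, hence fixed by Frobenius. *)
Lemma cst_z_free (z : L) a a' b b' : z ^+ q != z ->
  cst a + cst b * z = cst a' + cst b' * z -> a = a' /\ b = b'.
Proof.
move=> zq E.
have bb' : b = b'.
  apply/eqP; apply: contraNT zq; rewrite -subr_eq0 -(fmorph_eq0 cst) => nd.
  have -> : z = cst ((a' - a) / (b - b')).
    apply: (mulfI nd); rewrite fmorph_div [RHS]mulrC divfK // !rmorphB.
    apply/eqP; rewrite -subr_eq0.
    rewrite (_ : _ - _ = (cst a + cst b * z) - (cst a' + cst b' * z)).
      by rewrite E subrr.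
    by move: (cst a) (cst b) (cst a') (cst b') => A B A' B'; ring.
  by rewrite cst_expr_q.
by split=> //; move: E; rewrite bb' => /addIr /fmorph_inj.
Qed.

(** Either [z] is constant or it satisfies a quadratic equation over [F]. In the latter case
    [z ^+ q] is a root too: it equals [z], which is then constant, or the conjugate root, and trace
    and norm are the coefficients up to sign. *)
Lemma cst_of_rank2 (z E0 E1 : L) a0 a1 b0 b1 d0 d1 :
    1 = cst a0 * E0 + cst a1 * E1 -> z = cst b0 * E0 + cst b1 * E1 ->
    z ^+ 2 = cst d0 * E0 + cst d1 * E1 ->
  (exists a, z + z ^+ q = cst a) /\ (exists b, z ^+ q.+1 = cst b).
Proof.
move=> ea eb ed.
have in_cst c : z = cst c -> (exists a, z + z ^+ q = cst a)
    /\ (exists b, z ^+ q.+1 = cst b).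
  move=> ->; split; first by exists (c + c ^+ q); rewrite rmorphD rmorphXn.
  by exists (c ^+ q.+1); rewrite rmorphXn.
(* This is the determinant of the coordinates of 1 and [z]; when it vanishes, [z] is a constant
   multiple of 1. *)
have [D0|Dn] := eqVneq (a0 * b1 - a1 * b0) 0.
  have [a00|a0n] := eqVneq a0 0.
    have a1n : a1 != 0.
      apply: contra_eq_neq ea => a10.
      by rewrite a00 a10 rmorph0 !mul0r addr0 oner_neq0.
    have b00 : b0 = 0.
      move/eqP: D0; rewrite a00 mul0r sub0r oppr_eq0 mulf_eq0 (negPf a1n).
      by move/eqP.
    apply: (in_cst (b1 / a1)); rewrite eb b00 rmorph0 mul0r add0r -[RHS]mulr1 ea.
    by rewrite a00 rmorph0 mul0r add0r mulrA -rmorphM divfK.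
  apply: (in_cst (b0 / a0)); rewrite eb -[RHS]mulr1 ea mulrDr !mulrA -!rmorphM.
  rewrite divfK // mulrAC [b0 * a1]mulrC.
  by move/eqP: D0; rewrite subr_eq0 => /eqP <-; rewrite mulrAC divff // mul1r.
set D := a0 * b1 - a1 * b0 in Dn.
have eD : cst D != 0 by rewrite fmorph_eq0.
have E : cst D * z ^+ 2
    = cst (d0 * b1 - d1 * b0) * 1 + cst (d1 * a0 - d0 * a1) * z.
  rewrite ed ea eb /D !rmorphB !rmorphM.
  move: (cst a0) (cst a1) (cst b0) (cst b1) (cst d0) (cst d1) => A0 A1 B0 B1 C0 C1.
  by ring.
have [m [n zmn]] : exists m n, z ^+ 2 = cst m + cst n * z.
  exists ((d0 * b1 - d1 * b0) / D), ((d1 * a0 - d0 * a1) / D).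
  by apply: (mulfI eD); rewrite E !fmorph_div; field.
have zq2 : (z ^+ q) ^+ 2 = cst m + cst n * z ^+ q.
  by rewrite exprAC zmn (exprD_q hp hq hF cst) exprMn !cst_expr_q.
have : (z ^+ q - z) * (z ^+ q - (cst n - z)) = 0.
  rewrite (_ : _ * _ = (z ^+ q) ^+ 2 - cst n * z ^+ q - (z ^+ 2 - cst n * z)).
    by rewrite zq2 zmn !addrK subrr.
  by move: (z ^+ q) (cst n) => A B; ring.
move=> /eqP; rewrite mulf_eq0 !subr_eq0 => /orP[] /eqP zq.
  by have [c] := expr_q_const hF cst zq; exact: in_cst.
split; first by exists n; rewrite zq addrC subrK.
exists (- m); rewrite exprS zq rmorphN mulrBr -expr2 zmn.
by move: (cst m) (cst n) => A B; ring.
Qed.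

End Evaluation.
End Conductor.

(** * Residue fields and points of degree 2 *)

Section ProjectiveSpace.
Variables (k : fieldType) (n : nat).
Implicit Types (x : hprime k n) (f g : {mpoly k[n.+1]}).

Lemma hval_neq0 x f : (hval x f != 0) = (f \notin hp_mem x).
Proof. by rewrite hval_eq0. Qed.

Lemma zariski_openE (U : set (hprime k n)) : open U = zariski_open U.
Proof. by []. Qed.

Lemma dhomog_open d f : f \is d.-homog ->
  open [set x : hprime k n | f \notin hp_mem x]%classic.
Proof. by rewrite zariski_openE => hf x fx; exists d, f. Qed.

Lemma hreg_frac d f g (U : set (hprime k n)) :
    f \is d.-homog -> g \is d.-homog -> (forall x, U x -> g \notin hp_mem x) ->
  hreg (fun x (_ : U x) => hval x f / hval x g).
Proof.
move=> hf hg gU x Ux; exists [set y : hprime k n | g \notin hp_mem y]%classic, d, f, g.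
by split => //; [exact: dhomog_open hg | exact: gU].
Qed.

Lemma residueP x v : residue (X := projective_space k n) (x := x) v <->
  exists d f g, [/\ f \is d.-homog, g \is d.-homog, g \notin hp_mem x &
    v = hval x f / hval x g].
Proof.
split=> [[U [hx [s [Uo rs <-]]]]|[d [f [g [hf hg gx ->]]]]].
  have [V [d [f [g [Vo Vx hf hg sE]]]]] := rs x hx.
  by have [gx ->] := sE x hx Vx; exists d, f, g.
exists [set y : hprime k n | g \notin hp_mem y]%classic, gx.
exists (fun y _ => hval y f / hval y g); split => //; first exact: dhomog_open hg.
exact: hreg_frac hf hg _.
Qed.

End ProjectiveSpace.

Section Points.
Variables (p e q : nat) (F : finFieldType).
Hypotheses (hp : prime p) (he : (0 < e)%N) (hq : q = (p ^ e)%N) (hF : #|F| = q).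
Variables i j : 'I_2.
Hypothesis ij : i != j.
Notation S := {mpoly F[2]}.
Notation u := ('X_i : S).
Notation t := ('X_j : S).
Variable x : hprime F 1.
Hypothesis tx : t \notin hp_mem x.
Notation v := (hval x).
Notation z := (v u / v t).

Let cstE c : v c%:MP = hemb x c. Proof. by []. Qed.

Let vt : v t != 0. Proof. by rewrite hval_neq0. Qed.

(** 1 and [z] form a basis of the residue field: [frac_value] shows that they span, [cst_z_free]
    that they are independent. *)
Lemma has_degree2 : (exists a, z + z ^+ q = hemb x a) ->
    (exists b, z ^+ q.+1 = hemb x b) -> z ^+ q != z ->
  has_degree (X := projective_space F 1) 2 x.
Proof.
move=> za zb zq.
exists (fun k => if k == ord0 then 1 else z); split=> [k|y].
  apply/residueP; case: ifP => _.
    exists 0%N, 1, 1; split; try exact: dhomog1; last by rewrite rmorph1 divr1.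
    by rewrite -hval_neq0 rmorph1 oner_neq0.
  by exists 1%N, u, t; split => //; exact: dhomogX1.
move=> /residueP[d [f [g [hf hg gx ->]]]].
have vg : v g != 0 by rewrite hval_neq0.
have [c [c' ->]] : exists c c', v f / v g = hemb x c' + hemb x c * z.
  by move: za zb hf hg vg; exact: (frac_value hp hq hF ij vt cstE).
exists [ffun k : 'I_2 => if k == ord0 then c' else c]; split.
  by rewrite !big_ord_recl big_ord0 !ffunE /= mulr1 addr0.
move=> a; rewrite !big_ord_recl big_ord0 /= mulr1 addr0 => E.
have [E0 E1] : c' = a ord0 /\ c = a (lift ord0 ord0).
  exact: (cst_z_free hF (cst := hemb x) zq E).
apply/ffunP => k; rewrite ffunE; case: eqP => [-> //|/eqP k0].
by rewrite E1; congr (a _); apply: val_inj; case: k k0 => [[|[|//]] hk].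
Qed.

Lemma has_degree2_cst : has_degree (X := projective_space F 1) 2 x ->
  (exists a, z + z ^+ q = hemb x a) /\ (exists b, z ^+ q.+1 = hemb x b).
Proof.
move=> [E [_ hE]].
have base y : residue (X := projective_space F 1) (x := x) y ->
    exists a b, y = hemb x a * E ord0 + hemb x b * E ord_max.
  move=> /hE [c [-> _]]; exists (c ord0), (c ord_max).
  by rewrite !big_ord_recl big_ord0 addr0 /=; congr (_ + hemb x (c _) * E _);
    exact: val_inj.
have [a0 [a1 ea]] : exists a b, 1 = hemb x a * E ord0 + hemb x b * E ord_max.
  apply: base; apply/residueP; exists 0%N, 1, 1.
  split; try exact: dhomog1; last by rewrite rmorph1 divr1.
  by rewrite -hval_neq0 rmorph1 oner_neq0.
have [b0 [b1 eb]] : exists a b, z = hemb x a * E ord0 + hemb x b * E ord_max.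
  apply: base; apply/residueP.
  by exists 1%N, u, t; split => //; exact: dhomogX1.
have [d0 [d1 ed]] : exists a b, z ^+ 2 = hemb x a * E ord0 + hemb x b * E ord_max.
  apply: base; apply/residueP; exists 2%N, (u ^+ 2), (t ^+ 2).
  split; try exact: dhomogXn; last by rewrite !rmorphXn expr_div_n.
  by rewrite -hval_neq0 rmorphXn expf_neq0.
exact: (cst_of_rank2 hp hq hF ea eb ed).
Qed.

End Points.

(** * Functions near a point as fractions in the coordinates of Phi *)

Lemma degree_generic (d q : nat) : (0 < q)%N ->
  (d + (d * q).+1 + q.-1 = d * q.+1 + q)%N.
Proof. by rewrite mulnS; lia. Qed.

(** The degree count of [Phi_image_fraction] at a zero of the conductor; [N * q.+1] is the degree of
    the form [r ^+ q * g1] there. *)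
Lemma degree_special (d q : nat) (N := (q.-1 * q + d * q.+1)%N) : (0 < q)%N ->
  (d + (d * q).+1 + ((N * q).+1 + q.-1 * q.+1) = N * q.+1 + q.+1)%N.
Proof.
case: q @N => // q N _; rewrite [(N * _.+2)%N]mulnS {3}/N /=; move: (N * _)%N => X.
nia.
Qed.

Section LocalForm.
Variables (p e q : nat) (F : finFieldType).
Hypotheses (hp : prime p) (he : (0 < e)%N) (hq : q = (p ^ e)%N) (hF : #|F| = q).
Variables i j : 'I_2.
Hypothesis ij : i != j.
Notation S := {mpoly F[2]}.
Notation u := ('X_i : S).
Notation t := ('X_j : S).
Notation T := (t ^+ q.+1).
Notation w := (u * t ^+ q).
Notation w' := (u ^+ q * t).
Notation C := (conductor q F i j).
Variables (L : fieldType) (v : {rmorphism S -> L}).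
Hypothesis vt : v t != 0.
Variable cst : {rmorphism F -> L}.
Hypothesis cstE : forall c, v c%:MP = cst c.
Notation z := (v u / v t).

Let vT : v T != 0. Proof. by rewrite rmorphXn expf_neq0. Qed.

Lemma mderiv_q (f : S) : (f ^+ q)^`M(i) = 0.
Proof.
rewrite -(prednK (q_gt0 hp hq)) mderiv_expr (prednK (q_gt0 hp hq)).
by rewrite -mulr_natl (natr_q hp he hq hF (@mpolyC 2 F)) mul0r.
Qed.

Lemma mderiv_Xj n : (t ^+ n)^`M(i) = 0.
Proof.
case: n => [|n]; first by rewrite expr0 mderivC.
by rewrite mderiv_expr mderivXj eq_sym (negPf ij) mulr0 mul0rn.
Qed.

(* The conductor vanishes to first order only: conductor * (w' - w) has a
   partial derivative that is, up to sign, a power of t. *)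
Lemma conductor_squarefree (Q h : S) n :
  v Q = 0 -> t ^+ n * C = Q * (Q * h) -> False.
Proof.
move=> vQ E.
have E2 : t ^+ n * ((u ^+ q) ^+ q * t ^+ q - T ^+ q.-1 * w) = Q * (Q * (h * (w' - w))).
  rewrite -(conductor_sub hp he hq hF ij) mulrA E.
  by move: (w' - w) => A; rewrite !mulrA.
(* In characteristic p the left side has derivative minus a power of [t], which is nonzero at the
   point; on the right every term of the derivative keeps a factor [Q]. *)
have := congr1 (fun f => v f^`M(i)) E2; rewrite /= mderivM mderiv_Xj mul0r add0r.
rewrite mderivB mderivM mderiv_q mul0r mderiv_Xj mulr0 addr0 sub0r.
rewrite -[T ^+ _]exprM mderivM mderiv_Xj mul0r add0r mderivM mderivXj eqxx mul1r.
rewrite mderiv_Xj mulr0 addr0 mderivM mderivM => E3.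
have : v (t ^+ n * - (t ^+ (q.+1 * q.-1) * t ^+ q)) == 0.
  by rewrite E3 !(rmorphD, rmorphM) vQ !(mul0r, mulr0, addr0, add0r).
by rewrite rmorphM rmorphN rmorphM !rmorphXn mulrN oppr_eq0 !mulf_eq0 !expf_eq0
  (negPf vt) !andbF.
Qed.

(** Up to a power of [t] the remainder of [quad_div] takes the value c z + c'. It vanishes with [f],
    so both coefficients are zero, 1 and z being independent. *)
Lemma quad_dvd a b d (f : S) :
    z + z ^+ q = cst a -> z ^+ q.+1 = cst b -> z ^+ q != z ->
    f \is d.-homog -> v f = 0 ->
  exists2 g, g \is d.-homog & t ^+ 2 * f = quad i j a b * g.
Proof.
move=> za zb zq /(quad_div ij a b) [g [c [c' [hg E]]]] vf.
exists g => //; rewrite E.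
suff [-> ->] : c' = 0 /\ c = 0 by rewrite !scale0r addr0 mul0r addr0.
apply: (cst_z_free hF (cst := cst) (z := z)) => //.
rewrite rmorph0 mul0r addr0.
have := congr1 v E; rewrite rmorphM vf mulr0 rmorphD rmorphM.
rewrite (quad_root vt cstE za zb) mul0r add0r rmorphM rmorphXn => /esym/eqP.
rewrite mulf_eq0 (negPf (expf_neq0 _ vt)) orbF rmorphD -!mul_mpolyC !rmorphM !cstE.
move=> /eqP E1; apply: (mulIf vt); rewrite mul0r -E1.
by rewrite mulrDl mulrA divfK // addrC.
Qed.

(** Both [C] and [f] are divisible by the [quad] of the point. The cofactor [r] of [C] is a unit
    there because the zero of [C] is simple. *)
Lemma conductor_uniformizer d (f : S) :
    v C = 0 -> f \is d.-homog -> v f = 0 ->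
  exists r g, [/\ r \is (q.-1 * q.+1).-homog, g \is d.-homog, v r != 0 &
    r * f = C * g].
Proof.
move=> vC hf vf.
have [zqq zq] := conductor_root hp he hq hF ij vt cst vC.
have [[a za] [b zb]] := quad_root_cst hp hq hF cst zqq.
have hC := Phi_image_dhomog (conductor_image q F ij).
have [r hr Er] := quad_dvd za zb zq hC vC.
have [g hg Eg] := quad_dvd za zb zq hf vf.
exists r, g; split => //.
  (* If [r] vanished it would be divisible by [quad] in turn, and the square of [quad] would divide
     [t ^+ 4 * C]. *)
  apply/eqP => vr; have [r1 _ Er1] := quad_dvd za zb zq hr vr.
  apply: (@conductor_squarefree (quad i j a b) r1 4).
    exact: (quad_root vt cstE za zb).
  by rewrite -Er1 mulrCA -Er mulrA -exprD.
have t2 : t ^+ 2 != 0.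
  by apply: contraNneq (expf_neq0 2 vt) => t0; rewrite -rmorphXn t0 rmorph0.
by apply: (mulfI t2); rewrite mulrCA Eg mulrCA [RHS]mulrA Er -!mulrA [r * g]mulrC mulrCA mulrC.
Qed.

(** The factor [g ^+ q] makes the denominator a norm, and a power of [T] brings the numerator into
    the form [A0 + B0 * w]. The term [B0 * w] remains to be brought into the image. *)
Lemma Phi_image_fraction d (f g : S) :
    f \is d.-homog -> g \is d.-homog -> v g != 0 ->
    ((exists a, z + z ^+ q = cst a) -> (exists b, z ^+ q.+1 = cst b) ->
     z ^+ q != z -> exists c, v f / v g = cst c) ->
  exists D A B, [/\ Phi_image q D A, Phi_image q D B, v B != 0 & f * B = A * g].
Proof.
move=> hf hg vg glue.
have q0 := q_gt0 hp hq.
have [hP hT hS] := Phi_forms_chart F q ij.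
have hG := Phi_image_norm hp hq hF hg.
have hfg : f * g ^+ q \is (d * q.+1).-homog.
  by rewrite mulnS; apply: dhomogM => //; exact: dhomogMn.
have [A0 [B0 [hA0 hB0 E0]]] := Phi_span_dhomog ij hfg.
have hM := Phi_image_exp1 (d * q).+1 hT.
have hC := conductor_image q F ij.
have hCw := conductor_w_image hp he hq hF ij.
have vTn n : v (T ^+ n) != 0 by rewrite rmorphXn expf_neq0.
have vG : v (g ^+ q.+1) != 0 by rewrite rmorphXn expf_neq0.
(* Where [C] does not vanish, it can be multiplied through, as [C] and [C * w] are in the image. *)
have [vC|vC] := eqVneq (v C) 0; last first.
  exists (d + (d * q).+1 + q.-1)%N, (A0 * C + B0 * (C * w)),
    (g ^+ q.+1 * T ^+ (d * q).+1 * C); split.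
  - apply: Phi_imageD.
      by rewrite addnS -mulnS; exact: Phi_imageM.
    have -> : (d + (d * q).+1 + q.-1 = d * q.+1 + q)%N := degree_generic d q0.
    exact: Phi_imageM.
  - by do 2!apply: Phi_imageM => //.
  - by rewrite rmorphM mulf_neq0 // rmorphM mulf_neq0.
  have -> : A0 * C + B0 * (C * w) = C * (A0 + B0 * w).
    by move: C w => X Y; ring.
  rewrite -E0 [g ^+ q.+1]exprSr.
  by move: (g ^+ q) (T ^+ _) C => X Y Z; ring.
have [zqq zq] := conductor_root hp he hq hF ij vt cst vC.
have [za zb] := quad_root_cst hp hq hF cst zqq.
have [c Ec] := glue za zb zq.
(* Up to powers of [T], the values of [A0], [B0] and the norm of [g] are constants, and so is the
   value of [f / g]; since [w] is z times [T], the coefficient of z must be zero. *)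
have vB0 : v B0 = 0.
  have [b Eb] := Phi_image_value ij vt cstE za zb hB0.
  have [a Ea] := Phi_image_value ij vt cstE za zb hA0.
  have [l El] := Phi_image_value ij vt cstE za zb hG.
  suff [_ b0] : a = c * l /\ b = 0 by rewrite Eb b0 rmorph0 mul0r.
  apply: (cst_z_free hF (cst := cst) (z := z)) => //.
  rewrite rmorph0 mul0r addr0 rmorphM.
  have := congr1 v E0; rewrite rmorphM rmorphD [v (B0 * w)]rmorphM (eval_w _ _ vt) Ea Eb.
  have -> : v (f * g ^+ q) = cst c * v (g ^+ q.+1).
    by rewrite -Ec rmorphM !rmorphXn exprS mulrA divfK.
  rewrite El rmorphXn => E1.
  apply: (mulIf (expf_neq0 (d * q.+1).+1 vT)).
  have -> : cst c * cst l * v T ^+ (d * q.+1).+1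
      = v T ^+ (d * q).+1 * (cst c * (cst l * v T ^+ d)).
    have -> : ((d * q.+1).+1 = (d * q).+1 + d)%N by rewrite mulnS addSn addnC.
    by rewrite exprD; move: (v T ^+ _) (v T ^+ _) => X Y; ring.
  rewrite E1 exprS; move: (v T) (v T ^+ _) => X Y; ring.
(* Now [r * B0 = C * g1]. The factor [r ^+ q] completes [r] to its norm, and a power of [T] brings
   [r ^+ q * g1] into the span, where [conductorM_span] applies. *)
have [r [g1 [hr hg1 vr Er]]] := conductor_uniformizer vC (Phi_image_dhomog hB0) vB0.
have hrg : r ^+ q * g1 \is ((q.-1 * q + d * q.+1) * q.+1).-homog.
  rewrite mulnDl; apply: dhomogM => //.
  by rewrite mulnAC; exact: dhomogMn.
have hCg := conductorM_span hp he hq hF ij (Phi_span_dhomog ij hrg).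
have hR := Phi_image_norm hp hq hF hr.
move: hCg; set N := (q.-1 * q + d * q.+1)%N => hCg.
have hM' := Phi_image_exp1 (N * q).+1 hT.
exists (d + (d * q).+1 + ((N * q).+1 + q.-1 * q.+1))%N,
  (A0 * (T ^+ (N * q).+1 * r ^+ q.+1) + C * w * (T ^+ (N * q).+1 * (r ^+ q * g1))),
  (g ^+ q.+1 * T ^+ (d * q).+1 * (T ^+ (N * q).+1 * r ^+ q.+1)); split.
- apply: Phi_imageD.
    by rewrite [(d + _)%N]addnS -mulnS; do 2!apply: Phi_imageM => //.
  by rewrite (degree_special d q0).
- by do 2!apply: Phi_imageM => //.
- rewrite rmorphM mulf_neq0 //; first by rewrite rmorphM mulf_neq0.
  rewrite rmorphM; apply: mulf_neq0; first exact: vTn.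
  by rewrite rmorphXn; exact: expf_neq0.
have -> : C * w * (T ^+ (N * q).+1 * (r ^+ q * g1))
    = B0 * w * (T ^+ (N * q).+1 * r ^+ q.+1).
  rewrite [r ^+ q.+1]exprS.
  have -> : B0 * w * (T ^+ (N * q).+1 * (r * r ^+ q))
      = (r * B0) * w * (T ^+ (N * q).+1 * r ^+ q).
    by move: w (T ^+ _) (r ^+ q) => X Y Z; ring.
  by rewrite Er; move: C w (T ^+ _) (r ^+ q) => X Y Z Z'; ring.
rewrite -mulrDl -E0 [g ^+ q.+1]exprSr.
by move: (T ^+ _) (T ^+ _) (r ^+ _) (g ^+ _) => X Y Z Z'; ring.
Qed.

Lemma Phi_image_ratio d (f g : S) :
    (exists a, z + z ^+ q = cst a) -> (exists b, z ^+ q.+1 = cst b) ->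
    Phi_image q d f -> Phi_image q d g ->
  exists c, v f / v g = cst c.
Proof.
move=> za zb hf hg.
have [a ->] := Phi_image_value ij vt cstE za zb hf.
have [b ->] := Phi_image_value ij vt cstE za zb hg.
by exists (a / b); rewrite fmorph_div -mulf_div divff ?mulr1 // expf_neq0.
Qed.

End LocalForm.

(** * Arithmetic of fractions of values *)

Section RmorphFractions.
Variables (R : comNzRingType) (L : fieldType) (v : {rmorphism R -> L}).
Implicit Types f g : R.

Lemma rmorph_addf_div f g f' g' : v g != 0 -> v g' != 0 ->
  v f / v g + v f' / v g' = v (f * g' + f' * g) / v (g * g').
Proof. by move=> gx gx'; rewrite rmorphD !rmorphM addf_div. Qed.

Lemma rmorph_mulf_div f g f' g' :
  (v f / v g) * (v f' / v g') = v (f * f') / v (g * g').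
Proof. by rewrite !rmorphM mulf_div. Qed.

Lemma rmorph_eqr_div f g f' g' : v g != 0 -> v g' != 0 ->
  v f / v g = v f' / v g' <-> v (f * g' - f' * g) == 0.
Proof.
move=> gx gx'; rewrite rmorphB !rmorphM subr_eq0 -eqr_div //.
by split=> [/eqP|/eqP].
Qed.

End RmorphFractions.

Section HvalFractions.
Variables (k : fieldType) (n : nat) (x : hprime k n).
Implicit Types f g : {mpoly k[n.+1]}.

Lemma hval_addf_div f g f' g' : g \notin hp_mem x -> g' \notin hp_mem x ->
  hval x f / hval x g + hval x f' / hval x g'
    = hval x (f * g' + f' * g) / hval x (g * g').
Proof. by rewrite -!hval_neq0; exact: rmorph_addf_div. Qed.

Lemma hval_mulf_div f g f' g' : (hval x f / hval x g) * (hval x f' / hval x g')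
  = hval x (f * f') / hval x (g * g').
Proof. exact: rmorph_mulf_div. Qed.

Lemma hval_div_eq f g f' g' : g \notin hp_mem x -> g' \notin hp_mem x ->
  hval x f / hval x g = hval x f' / hval x g' <-> f * g' - f' * g \in hp_mem x.
Proof. by rewrite -!hval_neq0 -hval_eq0; exact: rmorph_eqr_div. Qed.

End HvalFractions.

(** * The map Phi on points and on residue fields *)

Section Isomorphism.
Local Open Scope classical_set_scope.
Variables (p e q : nat) (F : finFieldType).
Hypotheses (hp : prime p) (he : (0 < e)%N) (hq : q = (p ^ e)%N) (hF : #|F| = q).
Notation S := {mpoly F[2]}.
Notation "G '^Phi'" := (G \mPo Phi_forms F q) (at level 2, format "G ^Phi").
Notation P1 := (projective_space F 1).
Notation P2 := (projective_space F 2).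
Notation B := (reduced_subspace (X := P2) (range (@Phi F q))).
Implicit Types (x : hprime F 1) (y : hprime F 2) (G H : {mpoly F[3]}).

Lemma Phi_inE x G : (G \in hp_mem (Phi q x)) = (G^Phi \in hp_mem x).
Proof. by []. Qed.

Lemma hprime_chart x : exists i j : 'I_2, i != j /\ 'X_j \notin hp_mem x.
Proof.
have [j hj] := hp_relevant x; exists (rev_ord j), j; split => //.
by case: j {hj} => [[|[|//]] ?].
Qed.

Lemma hprime_fraction x d (f g : S) :
    f \is d.-homog -> g \is d.-homog -> g \notin hp_mem x ->
    (has_degree (X := P1) 2 x -> exists c, hval x f / hval x g = hemb x c) ->
  exists D G H, [/\ G \is D.-homog, H \is D.-homog, H^Phi \notin hp_mem x &
    f * H^Phi = G^Phi * g].
Proof.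
move=> hf hg gx glue; have [i [j [ij jx]]] := hprime_chart x.
have [|||D [_ [_ [[G hG ->] [H hH ->]]]]] := @Phi_image_fraction p e q F hp he hq hF i j ij
  (hfrac x) (hval x) _ (hemb x) (fun=> erefl) d f g hf hg.
- by rewrite hval_neq0.
- by rewrite hval_neq0.
- by move=> za zb zq; apply: glue; exact: (has_degree2 hp hq hF ij jx).
by rewrite hval_neq0 => Hx E; exists D, G, H.
Qed.

Lemma has_degree2_value x D G H : has_degree (X := P1) 2 x ->
    G \is D.-homog -> H \is D.-homog ->
  exists c, hval x G^Phi / hval x H^Phi = hemb x c.
Proof.
move=> x2 hG hH; have [i [j [ij jx]]] := hprime_chart x.
have [za zb] := has_degree2_cst hp hq hF i jx x2.
apply: (@Phi_image_ratio q F i j ij (hfrac x) (hval x) _ (hemb x) (fun=> erefl) D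
  _ _ za zb); last 2 first.
- by exists G.
- by exists H.
by rewrite hval_neq0.
Qed.

Lemma expr_in x (f : S) n : (f ^+ n.+1 \in hp_mem x) = (f \in hp_mem x).
Proof. by rewrite -!hval_eq0 rmorphXn expf_eq0. Qed.

(** A homogeneous prime contains the components of its members, so its forms determine it. *)
Lemma hprime_eq k n (x y : hprime k n) :
    (forall d f, f \is d.-homog -> f \in hp_mem x = (f \in hp_mem y)) -> x = y.
Proof.
move=> xy; have sub (x' y' : hprime k n) :
    (forall d f, f \is d.-homog -> f \in hp_mem x' = (f \in hp_mem y')) ->
    forall f, f \in hp_mem x' -> f \in hp_mem y'.
  move=> xy' f fx; rewrite (pihomog_partitionE (leqnn (mmeasure mdeg f))).
  apply: rpred_sum => d _; rewrite -(xy' d) ?pihomogP //; exact: hp_homog.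
have : hp_mem x = hp_mem y.
  apply/funext => f; apply/idP/idP; first exact: sub.
  by apply: sub => d g hg; rewrite (xy d).
case: x {xy sub} => mx x1 x2 x3 x4; case: y => my y1 y2 y3 y4 /= E.
by subst my; congr HPrime; exact: Prop_irrelevance.
Qed.

(** A form lies in a prime exactly when its norm does, and the norm is a form in the coordinates of
    Phi; membership is thus visible in the image. *)
Lemma Phi_inj : injective (@Phi F q).
Proof.
move=> x x' xx'; apply: hprime_eq => d f hf.
have [G _ E] := Phi_image_norm hp hq hF hf.
by rewrite -(expr_in x f q) -(expr_in x' f q) E -!Phi_inE xx'.
Qed.

Lemma Phi_continuous_open (U : set (hprime F 2)) : open U -> open (@Phi F q @^-1` U).
Proof.
rewrite !zariski_openE => Uo x Ux; have [d [G [hG Gx GU]]] := Uo _ Ux.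
exists (d * q.+1)%N, G^Phi; split => //; first by apply: Phi_image_dhomog; exists G.
by move=> x' Gx'; apply: GU.
Qed.

(** The locus where [f] does not vanish is that of its norm, and so the preimage of a basic open set
    of the plane. *)
Lemma Phi_embedding (U : set (hprime F 1)) : open U ->
  exists2 W : set (hprime F 2), open W & forall x, W (Phi q x) <-> U x.
Proof.
rewrite zariski_openE => Uo.
exists [set y | exists d f G, [/\ G \is d.-homog, f ^+ q.+1 = G^Phi,
    (forall x, f \notin hp_mem x -> U x) & G \notin hp_mem y]].
  rewrite zariski_openE => y [d [f [G [hG fG fU Gy]]]]; exists d, G; split => //.
  by move=> y' Gy'; exists d, f, G.
move=> x; split=> [[d [f [G [hG fG fU Gx]]]]|/Uo [d [f [hf fx fU]]]].
  by apply: fU; rewrite -(expr_in x f q) fG.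
have [G hG fG] := Phi_image_norm hp hq hF hf.
by exists d, f, G; split => //; rewrite Phi_inE -fG expr_in.
Qed.

(** [a] and [b] are the values of one fraction at [y] and at [x]. The point [y] is kept free because
    a point of the image equals Phi of its preimage only propositionally. *)
Definition Phi_related x y (a : hfrac y) (b : hfrac x) := exists G H,
  [/\ H^Phi \notin hp_mem x, a = hval y G / hval y H &
      b = hval x G^Phi / hval x H^Phi].

Lemma Phi_related_inj x (a a' : hfrac (Phi q x)) (b b' : hfrac x) :
  Phi_related a b -> Phi_related a' b' -> a = a' <-> b = b'.
Proof.
move=> [G [H [hH -> ->]]] [G' [H' [hH' -> ->]]].
by rewrite !hval_div_eq // Phi_inE rmorphB !rmorphM.
Qed.

Lemma Phi_relatedD x (a a' : hfrac (Phi q x)) (b b' : hfrac x) :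
  Phi_related a b -> Phi_related a' b' -> Phi_related (a + a') (b + b').
Proof.
move=> [G [H [hH -> ->]]] [G' [H' [hH' -> ->]]].
exists (G * H' + G' * H), (H * H'); rewrite comp_mpolyD !(rmorphM (comp_mpoly _)).
by split; rewrite ?hval_addf_div // (prime_idealrM (hp_mem x)) negb_or hH.
Qed.

Lemma Phi_relatedM x (a a' : hfrac (Phi q x)) (b b' : hfrac x) :
  Phi_related a b -> Phi_related a' b' -> Phi_related (a * a') (b * b').
Proof.
move=> [G [H [hH -> ->]]] [G' [H' [hH' -> ->]]].
exists (G * G'), (H * H'); rewrite !(rmorphM (comp_mpoly _)).
by split; rewrite ?hval_mulf_div // (prime_idealrM (hp_mem x)) negb_or hH.
Qed.

Lemma Phi_related_const x c : Phi_related (hemb (Phi q x) c) (hemb x c).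
Proof.
exists c%:MP, 1; rewrite comp_mpolyC comp_mpoly1 !rmorph1 !divr1.
by split; rewrite // (idealr1 (hp_mem x)).
Qed.

(** The default 0 is taken only where no fraction represents [a]; a value of a regular section
    always has a related [b], by [reduced_related]. *)
Definition Phi_pull x (a : hfrac (Phi q x)) : hfrac x :=
  xget 0 [set b | Phi_related a b].

Lemma Phi_pullE x a b : Phi_related a b -> @Phi_pull x a = b.
Proof.
move=> ab; have ab' : Phi_related a (Phi_pull a) by apply: (xgetPex 0); exists b.
exact/(Phi_related_inj ab' ab).
Qed.

Definition Phi_push x y (b : hfrac x) : hfrac y :=
  xget 0 [set a | Phi_related a b].

Lemma Phi_pushE x y (a : hfrac y) (b : hfrac x) :
  y = Phi q x -> Phi_related a b -> Phi_push y b = a.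
Proof.
move=> yx; subst y => ab.
have ab' : Phi_related (Phi_push (Phi q x) b) b.
  exact: (@xgetPex _ 0 [set a' : hfrac (Phi q x) | Phi_related a' b] (ex_intro _ a ab)).
exact/(Phi_related_inj ab' ab).
Qed.

(** * The isomorphism on points and on sections *)

Definition Phi_point (x : glue2 P1) : B :=
  exist _ (Phi q x) (mem_set (imageT (@Phi F q) x)).

Definition Phi_point_inv (b : B) : glue2 P1 := s2val (cid2 (set_valP b)).

Lemma Phi_point_invE (b : B) : Phi q (Phi_point_inv b) = functions.set_val b.
Proof. exact: (s2valP' (cid2 (set_valP b))). Qed.

Lemma Phi_pointK : cancel Phi_point Phi_point_inv.
Proof. by move=> x; apply: Phi_inj; rewrite Phi_point_invE. Qed.

Lemma Phi_point_invK : cancel Phi_point_inv Phi_point.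
Proof. by move=> b; apply: val_inj; rewrite /= Phi_point_invE. Qed.

Lemma open_rangeP (V : set B) : open V <->
  exists2 U : set (hprime F 2), open U & functions.set_val @^-1` U = V.
Proof. by split=> -[U Uo UV]; exists U. Qed.

Lemma Phi_point_continuous : continuous Phi_point.
Proof.
apply/continuousP => V /open_rangeP [U Uo <-].
exact: (Phi_continuous_open Uo).
Qed.

Lemma Phi_point_inv_continuous : continuous Phi_point_inv.
Proof.
apply/continuousP => U /Phi_embedding [W Wo WU]; apply/open_rangeP; exists W => //.
by apply/seteqP; split => b /=; rewrite -Phi_point_invE => /WU.
Qed.

Definition Phi_sec (V : set B) (s : sections V) :
    sections (X := glue2 P1) (Phi_point @^-1` V) :=
  fun x hx => Phi_pull (s (Phi_point x) hx).

Lemma reduced_fraction (V : set B) (s : sections V) (b : B) : reg s -> V b ->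
  exists U d G H, [/\ open U, U (functions.set_val b), G \is d.-homog, H \is d.-homog &
    forall b' (hb' : V b'), U (functions.set_val b') ->
      H \notin hp_mem (functions.set_val b')
      /\ s b' hb' = hval (functions.set_val b') G / hval (functions.set_val b') H].
Proof.
move=> rs Vb; have [U [t [Uo Ub rt st]]] := rs b Vb.
have [W [d [G [H [Wo Wb hG hH tE]]]]] := rt _ Ub.
exists (U `&` W), d, G, H; split => //; first exact: openI.
by move=> b' Vb' [Ub' Wb']; rewrite (st b' Vb' Ub'); exact: tE.
Qed.

Lemma reduced_related (V : set B) (s : sections V) x (hx : V (Phi_point x)) :
  reg s -> exists b, @Phi_related x (Phi q x) (s (Phi_point x) hx) b.
Proof.
move=> rs; have [U [d [G [H [_ Ux _ _ sE]]]]] := reduced_fraction rs hx.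
have [Hx ->] := sE _ hx Ux.
by exists (hval x G^Phi / hval x H^Phi), G, H.
Qed.

(** The gluing condition at [x] is what [hprime_fraction] asks for. The resulting identity holds
    between polynomials, so it persists wherever both denominators are nonzero. *)
Lemma glue2_fraction (U : set (glue2 P1)) (t : sections (X := glue2 P1) U) x :
    reg (r := glue2 P1) t -> U x ->
  exists W D G H, [/\ open W, W x, G \is D.-homog, H \is D.-homog &
    forall x' (hx' : U x'), W x' -> H^Phi \notin hp_mem x'
      /\ t x' hx' = hval x' G^Phi / hval x' H^Phi].
Proof.
move=> [rt dt] Ux; have [V [d [f [g [Vo Vx hf hg tE]]]]] := rt x Ux.
have [gx tx] := tE x Ux Vx.
have [|D [G [H [hG hH Hx E]]]] := hprime_fraction hf hg gx.
  by move=> x2; rewrite -tx; exact: dt x Ux x2.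
exists (V `&` [set x' | H^Phi \notin hp_mem x']), D, G, H; split => //.
  apply: openI => //; apply: (@dhomog_open _ _ (D * q.+1)).
  by apply: Phi_image_dhomog; exists H.
move=> x' Ux' [Vx' Hx']; split => //.
have [gx' ->] := tE x' Ux' Vx'; apply/hval_div_eq => //.
by rewrite E subrr (idealr0 (hp_mem x')).
Qed.

(** Local fractions pull back by substitution, and at a point of degree 2 a fraction in the
    coordinates of Phi has its value in [F], which is the gluing condition. *)
Lemma Phi_sec_reg (V : set B) (s : sections V) : open V ->
  reg s -> reg (r := glue2 P1) (Phi_sec s).
Proof.
move=> Vo rs.
have loc x (hx : V (Phi_point x)) : exists W D G H,
    [/\ open W, W x, G \is D.-homog, H \is D.-homog &
     forall x' (hx' : V (Phi_point x')), W x' -> H^Phi \notin hp_mem x'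
       /\ Phi_sec s hx' = hval x' G^Phi / hval x' H^Phi].
  have [U [D [G [H [Uo Ux hG hH sE]]]]] := reduced_fraction rs hx.
  exists (@Phi F q @^-1` U), D, G, H; split => //; first exact: Phi_continuous_open.
  move=> x' hx' Ux'; have [Hx' Es] := sE _ hx' Ux'; split => //.
  by apply: Phi_pullE; exists G, H.
split=> x hx; have [W [D [G [H [Wo Wx hG hH sE]]]]] := loc x hx.
  exists W, (D * q.+1)%N, G^Phi, H^Phi; split => //; apply: Phi_image_dhomog.
    by exists G.
  by exists H.
by move=> x2; have [_ ->] := sE x hx Wx; exact: has_degree2_value x2 hG hH.
Qed.

Lemma Phi_point_surj (b : B) : exists x, b = Phi_point x.
Proof. by exists (Phi_point_inv b); rewrite Phi_point_invK. Qed.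

Lemma Phi_sec_inj (V : set B) (s t : sections V) :
  reg s -> reg t -> Phi_sec s = Phi_sec t -> s = t.
Proof.
move=> rs rt st; apply: functional_extensionality_dep => b.
apply: functional_extensionality_dep => hb.
have [x bx] := Phi_point_surj b; move: hb; rewrite bx => hx.
have [b1 r1] := reduced_related hx rs; have [b2 r2] := reduced_related hx rt.
have := congr1 (fun f : sections (X := glue2 P1) (Phi_point @^-1` V) => f x hx) st.
by rewrite /Phi_sec (Phi_pullE r1) (Phi_pullE r2) => b12; exact/(Phi_related_inj r1 r2).
Qed.

(** The values are pushed forward point by point; [glue2_fraction] and [Phi_embedding] then show
    that the result is locally a fraction on the plane. *)
Lemma Phi_sec_surj (V : set B)
    (t : sections (X := glue2 P1) (Phi_point @^-1` V)) :
  reg (r := glue2 P1) t -> exists2 s : sections V, reg s & Phi_sec s = t.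
Proof.
move=> rt.
have V_inv (b : B) : V b -> V (Phi_point (Phi_point_inv b)).
  by rewrite Phi_point_invK.
pose s : sections V := fun b hb => @Phi_push (Phi_point_inv b) (functions.set_val b)
  (t (Phi_point_inv b) (V_inv b hb)).
have loc b : V b -> exists W D G H, [/\ open W, W (functions.set_val b),
    G \is D.-homog, H \is D.-homog &
    forall b' (hb' : V b'), W (functions.set_val b') -> [/\
      H \notin hp_mem (functions.set_val b'),
      s b' hb' = hval (functions.set_val b') G / hval (functions.set_val b') H &
      Phi_related (s b' hb') (t (Phi_point_inv b') (V_inv b' hb'))]].
  move=> hb; have [U [D [G [H [Uo Ub hG hH tE]]]]] := glue2_fraction rt (V_inv b hb).
  have [W Wo WU] := Phi_embedding Uo; exists W, D, G, H; split => //.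
    by rewrite -Phi_point_invE; exact/WU.
  move=> b' hb'; rewrite -{1}Phi_point_invE => /WU Ub'.
  have [Hb' tb'] := tE _ (V_inv b' hb') Ub'.
  have r : @Phi_related (Phi_point_inv b') (functions.set_val b')
      (hval (functions.set_val b') G / hval (functions.set_val b') H)
      (t (Phi_point_inv b') (V_inv b' hb')) by exists G, H.
  have sb' : s b' hb'
      = hval (functions.set_val b') G / hval (functions.set_val b') H.
    exact: (Phi_pushE (esym (Phi_point_invE b')) r).
  by split; rewrite ?sb' // -Phi_point_invE Phi_inE.
exists s.
  move=> b hb; have [W [D [G [H [Wo Wb hG hH sE]]]]] := loc b hb.
  exists (W `&` [set y | H \notin hp_mem y]), (fun y _ => hval y G / hval y H).
  split.
  - by apply: openI => //; exact: dhomog_open hH.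
  - by split => //; have [] := sE b hb Wb.
  - by apply: (hreg_frac hG hH) => y [].
  - by move=> b' hb' [Wb' _]; have [] := sE b' hb' Wb'.
apply: functional_extensionality_dep => x; apply: functional_extensionality_dep => hx.
apply: Phi_pullE; have [W [D [G [H [_ Wx _ _ sE]]]]] := loc _ hx.
have [_ _] := sE _ hx Wx; move: (s _ hx) => a.
(* Once [Phi_pointK] identifies the points, only the two membership proofs differ. *)
move: (V_inv _ hx); rewrite Phi_pointK => hx'.
by rewrite (Prop_irrelevance hx' hx).
Qed.

Lemma Phi_iso : isomorphic (glue2 P1) B.
Proof.
constructor.
apply: (@Iso F (glue2 P1) B Phi_point Phi_point_inv Phi_pointK Phi_point_invK
  Phi_point_continuous Phi_point_inv_continuous Phi_sec) => //.
- exact: Phi_sec_reg.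
- by move=> V s t _; exact: Phi_sec_inj.
- by move=> V t _; exact: Phi_sec_surj.
- move=> V c _; apply: functional_extensionality_dep => x.
  apply: functional_extensionality_dep => hx.
  exact: (Phi_pullE (Phi_related_const x c)).
- move=> V s t _ rs rt; apply: functional_extensionality_dep => x.
  apply: functional_extensionality_dep => hx.
  have [b1 r1] := reduced_related hx rs; have [b2 r2] := reduced_related hx rt.
  by rewrite /Phi_sec (Phi_pullE r1) (Phi_pullE r2); exact: Phi_pullE (Phi_relatedD r1 r2).
- move=> V s t _ rs rt; apply: functional_extensionality_dep => x.
  apply: functional_extensionality_dep => hx.
  have [b1 r1] := reduced_related hx rs; have [b2 r2] := reduced_related hx rt.
  by rewrite /Phi_sec (Phi_pullE r1) (Phi_pullE r2); exact: Phi_pullE (Phi_relatedM r1 r2).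
Qed.

End Isomorphism.

Theorem proposition1 (p e q : nat) (F : finFieldType)
    (hp : prime p) (he : (0 < e)%N) (hq : q = (p ^ e)%N) (hF : #|F| = q) :
  isomorphic (glue2 (projective_space F 1))
    (reduced_subspace (X := projective_space F 2) (range (@Phi F q))).
Proof. exact: Phi_iso hp he hq hF. Qed.
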